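(* Assume that the field $\mathbb{F}_q$, together with a primitive element $\omega$, has been constructed, where $q = 2^{2m+1}$ for some $m > 0$. There exists a deterministic algorithm that, given \begin{itemize} \item a simple black box group $G = \langle X \rangle$ such that $G \cong \mathrm{Sz}(q)$, \item standard generators $Y = \{x, y, z\} \subset G$, that is, elements such that $x \mapsto \hat{x}$, $y \mapsto \hat{y}$, $z \mapsto \hat{z}$ induces an isomorphism $G \to \mathrm{Sz}(q)$, \item $g \in U \geqslant G$ for some overgroup $U$ of $G$, \end{itemize} decides whether or not $g \in G$, and if so, expresses $g$ as a straight line program in $Y$. The algorithm has time complexity $\Theta(q\mu)$. The length of the returned straight line program is $O(\log q)$.
   Context: Standard generators: let $q = 2^{2m+1}$ with $m>0$, $t = 2^{m+1} = \sqrt{2q}$, and $\omega$ a primitive element (generator of the multiplicative group) of $\mathbb{F}_q$. Put $$\hat{x} = \begin{bmatrix} 1&0&0&0\\ 1&1&0&0\\ 1&1&1&0\\ 1&0&1&1 \end{bmatrix},\quad \hat{y} = \mathrm{diag}(\omega^{t/2+1}, \omega^{t/2}, \omega^{-t/2}, \omega^{-t/2-1}),\quad \hat{z} = \begin{bmatrix} 0&0&0&1\\ 0&0&1&0\\ 0&1&0&0\\ 1&0&0&0 \end{bmatrix}.$$ The Suzuki group is $\mathrm{Sz}(q) = \langle \hat{x}, \hat{y}, \hat{z}\rangle \leqslant \mathrm{GL}(4,q)$. Black box group: a group whose elements are encoded as strings of uniform length over a finite alphabet, equipped with an oracle (the black box) that can construct a string representing the product of two given elements, construct a string representing the inverse of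 a given element, and test whether a given element is the identity. Time complexity is measured in bit operations, and $\mu$ denotes the time complexity of the group operation (number of bit operations required by the black box). Straight line program (SLP) in a set $Y$: a data structure for a word in $Y$, a list of cells, each cell representing an operation such as a group multiplication, so that subwords occurring several times need not be recomputed. Multiplication and inversion increase the length of an SLP by $1$; raising an element to a power $k$ increases the length by $\log(k)$ (repeated squaring). *)

(* Defs.v *)
From HB Require Import structures.
From mathcomp Require Import all_boot all_order all_algebra all_fingroup.
From mathcomp Require Import all_solvable all_field.

Set Implicit Arguments.
Unset Strict Implicit.
Unset Printing Implicit Defensive.

Import GRing.Theory.

Definition suzq (m : nat) : nat := 2 ^ (2 * m + 1).
Definition suzt (m : nat) : nat := 2 ^ m.+1.

Section SuzukiGroup.
Local Open Scope ring_scope.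

Variables (F : finFieldType) (m : nat) (omega : {unit F}).

Let w : F := FinRing.uval omega.
Let t2 : nat := (suzt m)./2.

Definition mx4 (s : seq (seq F)) : 'M[F]_4 :=
  \matrix_(i < 4, j < 4) nth 0 (nth [::] s i) j.

Definition xhat_mx : 'M[F]_4 := mx4
  [:: [:: 1; 0; 0; 0];
      [:: 1; 1; 0; 0];
      [:: 1; 1; 1; 0];
      [:: 1; 0; 1; 1]].

Definition yhat_mx : 'M[F]_4 := diag_mx
  (\row_(j < 4) nth 0 [:: w ^+ t2.+1; w ^+ t2; w ^- t2; w ^- t2.+1] j).

Definition zhat_mx : 'M[F]_4 := mx4
  [:: [:: 0; 0; 0; 1];
      [:: 0; 0; 1; 0];
      [:: 0; 1; 0; 0];
      [:: 1; 0; 0; 0]].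

Lemma xhat_unit : xhat_mx \is a GRing.unit.
Proof.
have trigx : is_trig_mx xhat_mx.
  by apply/is_trig_mxP=> -[[|[|[|[|i]]]] hi] -[[|[|[|[|j]]]] hj] //= _;
    rewrite mxE.
by rewrite -[_ \is a _]/(_ \in unitmx) unitmxE (det_trig trigx)
  !big_ord_recl big_ord0 !mxE /= !mulr1 unitr1.
Qed.

Lemma yhat_unit : yhat_mx \is a GRing.unit.
Proof.
have w0 : w \is a GRing.unit by apply: (valP omega).
by rewrite -[_ \is a _]/(_ \in unitmx) unitmxE det_diag
  !big_ord_recl big_ord0 !mxE /= mulr1 !unitrM ?unitrV ?unitrX.
Qed.

Lemma zhat_unit : zhat_mx \is a GRing.unit.
Proof.
suff /mulmx1_unit[] : zhat_mx *m zhat_mx = 1%:M by [].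
apply/matrixP=> -[[|[|[|[|i]]]] hi] -[[|[|[|[|j]]]] hj] //;
  by rewrite !mxE !big_ord_recl big_ord0 !mxE /= ?(mulr0, mul0r, mulr1, addr0, add0r).
Qed.

Definition xhat : {'GL_4[F]} := FinRing.unit _ xhat_unit.
Definition yhat : {'GL_4[F]} := FinRing.unit _ yhat_unit.
Definition zhat : {'GL_4[F]} := FinRing.unit _ zhat_unit.

Definition Sz : {group {'GL_4[F]}} := <<[set xhat; yhat; zhat]>>%G.

Definition standard_generators (gT : finGroupType) (G : {group gT})
    (x y z : gT) : Prop :=
  [/\ x \in G, y \in G, z \in G &
      exists f : {morphism G >-> {'GL_4[F]}},
        [/\ isom G Sz f, f x = xhat, f y = yhat & f z = zhat]].

End SuzukiGroup.

(* A constructed field of order 2 ^ n: the element a is represented by the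
   natural number [fc_code a] < 2 ^ n whose binary digits are the coordinates
   of a in the polynomial basis 1, alpha, .., alpha ^ n.-1. *)
Record field_construction (F : finFieldType) (n : nat) := FieldConstruction {
  fc_alpha : F;
  fc_code : F -> nat;
  fc_card : #|F| = 2 ^ n;
  fc_code_lt : forall a, fc_code a < 2 ^ n;
  fc_codeK : forall a : F,
    a = (\sum_(i < n) (odd (fc_code a %/ 2 ^ i))%:R * fc_alpha ^+ i)%R
}.

(* The minimal polynomial of alpha over the prime field, as a bit string. *)
Definition fc_modulus (F : finFieldType) (n : nat)
    (fc : field_construction F n) : nat :=
  2 ^ n + fc_code fc (fc_alpha fc ^+ n)%R.

(* Not every string need encode an element, and an element may have several
   codes. [mu] is the number of bit operations of one oracle call; as a call
   reads and writes whole strings, it is at least their length in bits. *)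
Record blackbox (gT : finGroupType) (U : {group gT}) (mu : nat) := BlackBox {
  bb_alphabet : finType;
  bb_len : nat;
  bb_valid : pred (bb_len.-tuple bb_alphabet);
  bb_elt : bb_len.-tuple bb_alphabet -> gT;
  bb_mul : bb_len.-tuple bb_alphabet -> bb_len.-tuple bb_alphabet ->
           bb_len.-tuple bb_alphabet;
  bb_inv : bb_len.-tuple bb_alphabet -> bb_len.-tuple bb_alphabet;
  bb_is1 : bb_len.-tuple bb_alphabet -> bool;
  bb_elt_in : forall s, bb_valid s -> bb_elt s \in U;
  bb_elt_onto : forall u, u \in U -> exists2 s, bb_valid s & bb_elt s = u;
  bb_mul_valid : forall s1 s2, bb_valid s1 -> bb_valid s2 ->
    bb_valid (bb_mul s1 s2);
  bb_mulE : forall s1 s2, bb_valid s1 -> bb_valid s2 ->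
    bb_elt (bb_mul s1 s2) = (bb_elt s1 * bb_elt s2)%g;
  bb_inv_valid : forall s, bb_valid s -> bb_valid (bb_inv s);
  bb_invE : forall s, bb_valid s -> bb_elt (bb_inv s) = (bb_elt s)^-1%g;
  bb_is1E : forall s, bb_valid s -> bb_is1 s = (bb_elt s == 1%g);
  bb_len_le : bb_len * up_log 2 #|bb_alphabet| <= mu
}.

Definition bb_string (gT : finGroupType) (U : {group gT}) (mu : nat)
    (B : blackbox U mu) : finType := (bb_len B).-tuple (bb_alphabet B).

(* A cell refers by number to earlier values, counting from 0 and starting
   with the elements of Y. *)
Inductive slp_cell : Type :=
  | CMul of nat & nat
  | CInv of nat
  | CPow of nat & nat.

Definition slp : Type := seq slp_cell.

Section SLPValue.
Variable gT : finGroupType.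

Definition cell_value (vals : seq gT) (c : slp_cell) : option gT :=
  match c with
  | CMul i j => if (onth vals i, onth vals j) is (Some u, Some v)
                then Some (u * v)%g else None
  | CInv i => omap (fun u => u^-1%g) (onth vals i)
  | CPow i k => omap (fun u => (u ^+ k)%g) (onth vals i)
  end.

Fixpoint slp_run (vals : seq gT) (s : slp) : option (seq gT) :=
  if s is c :: s' then
    if cell_value vals c is Some v then slp_run (rcons vals v) s' else None
  else Some vals.

(* [None] on a dangling reference; otherwise the value of the last cell. *)
Definition slp_value (Y : seq gT) (s : slp) : option gT :=
  omap (last 1%g) (slp_run Y s).

End SLPValue.

Definition cell_length (c : slp_cell) : nat :=
  if c is CPow _ k then maxn 1 (up_log 2 k) else 1.

Definition slp_length (s : slp) : nat := sumn (map cell_length s).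

(* Programs of a random access machine with a memory of natural numbers
   (addresses given by constants, or by memory contents in the load and store
   commands), a memory of black box strings, accessible only through the
   oracle, and a write-only tape for the cells of an SLP. *)
Inductive prog : Type :=
  | Skip
  | Const of nat & nat                   (* n[d] := c *)
  | Add of nat & nat & nat               (* n[d] := n[a] + n[b] *)
  | Sub of nat & nat & nat               (* n[d] := n[a] - n[b], truncated *)
  | Xor of nat & nat & nat               (* n[d] := n[a] xor n[b], bitwise *)
  | Half of nat & nat                    (* n[d] := n[a]./2 *)
  | NLoad of nat & nat                   (* n[d] := n[n[a]] *)
  | NStore of nat & nat                  (* n[n[a]] := n[b] *)
  | EMul of nat & nat & nat              (* e[d] := e[a] * e[b] *)
  | EInv of nat & nat                    (* e[d] := e[a]^-1 *)
  | EIs1 of nat & nat                    (* n[d] := (e[a] == 1) *)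
  | ELoad of nat & nat                   (* e[d] := e[n[a]] *)
  | EStore of nat & nat                  (* e[n[a]] := e[b] *)
  | EmitMul of nat & nat                 (* append CMul n[a] n[b] *)
  | EmitInv of nat                       (* append CInv n[a] *)
  | EmitPow of nat & nat                 (* append CPow n[a] n[b] *)
  | Seq of prog & prog
  | If of nat & prog & prog              (* tests n[r] != 0 *)
  | While of nat & prog.                 (* tests n[r] != 0 *)

Section Semantics.

Variables (gT : finGroupType) (U : {group gT}) (mu : nat) (B : blackbox U mu).

Record state := State {
  nmem : nat -> nat;
  emem : nat -> bb_string B;
  tape : slp
}.

Definition upd (T : Type) (f : nat -> T) (d : nat) (v : T) : nat -> T :=
  fun i => if i == d then v else f i.

Definition setn (s : state) (d v : nat) : state :=
  State (upd (nmem s) d v) (emem s) (tape s).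
Definition sete (s : state) (d : nat) (v : bb_string B) : state :=
  State (nmem s) (upd (emem s) d v) (tape s).
Definition emit (s : state) (c : slp_cell) : state :=
  State (nmem s) (emem s) (rcons (tape s) c).

Definition bitlen (n : nat) : nat := (trunc_log 2 n).+1.

Definition copy_cost : nat := (bb_len B * up_log 2 #|bb_alphabet B|).+1.

(* [exec p s t s']: started in [s], [p] halts in [s'] after [t] bit operations
   (logarithmic cost, and [mu] for each call to the black box). *)
Inductive exec : prog -> state -> nat -> state -> Prop :=
  | XSkip s : exec Skip s 1 s
  | XConst s d c : exec (Const d c) s (bitlen c) (setn s d c)
  | XAdd s d a b : exec (Add d a b) s (bitlen (nmem s a) + bitlen (nmem s b))
      (setn s d (nmem s a + nmem s b))
  | XSub s d a b : exec (Sub d a b) s (bitlen (nmem s a) + bitlen (nmem s b))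
      (setn s d (nmem s a - nmem s b))
  | XXor s d a b : exec (Xor d a b) s (bitlen (nmem s a) + bitlen (nmem s b))
      (setn s d (Nat.lxor (nmem s a) (nmem s b)))
  | XHalf s d a : exec (Half d a) s (bitlen (nmem s a))
      (setn s d (nmem s a)./2)
  | XLoad s d a : exec (NLoad d a) s
      (bitlen (nmem s a) + bitlen (nmem s (nmem s a)))
      (setn s d (nmem s (nmem s a)))
  | XStore s a b : exec (NStore a b) s (bitlen (nmem s a) + bitlen (nmem s b))
      (setn s (nmem s a) (nmem s b))
  | XEMul s d a b : exec (EMul d a b) s mu
      (sete s d (bb_mul (emem s a) (emem s b)))
  | XEInv s d a : exec (EInv d a) s mu (sete s d (bb_inv (emem s a)))
  | XEIs1 s d a : exec (EIs1 d a) s mu (setn s d (bb_is1 (emem s a)))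
  | XELoad s d a : exec (ELoad d a) s (bitlen (nmem s a) + copy_cost)
      (sete s d (emem s (nmem s a)))
  | XEStore s a b : exec (EStore a b) s (bitlen (nmem s a) + copy_cost)
      (sete s (nmem s a) (emem s b))
  | XEmitMul s a b : exec (EmitMul a b) s
      (bitlen (nmem s a) + bitlen (nmem s b))
      (emit s (CMul (nmem s a) (nmem s b)))
  | XEmitInv s a : exec (EmitInv a) s (bitlen (nmem s a))
      (emit s (CInv (nmem s a)))
  | XEmitPow s a b : exec (EmitPow a b) s
      (bitlen (nmem s a) + bitlen (nmem s b))
      (emit s (CPow (nmem s a) (nmem s b)))
  | XSeq p1 p2 s t1 s1 t2 s2 :
      exec p1 s t1 s1 -> exec p2 s1 t2 s2 -> exec (Seq p1 p2) s (t1 + t2) s2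
  | XIfT r p1 p2 s t s1 : nmem s r != 0 ->
      exec p1 s t s1 -> exec (If r p1 p2) s (bitlen (nmem s r) + t) s1
  | XIfF r p1 p2 s t s1 : nmem s r = 0 ->
      exec p2 s t s1 -> exec (If r p1 p2) s (bitlen (nmem s r) + t) s1
  | XWhileT r p s t1 s1 t2 s2 : nmem s r != 0 ->
      exec p s t1 s1 -> exec (While r p) s1 t2 s2 ->
      exec (While r p) s (bitlen (nmem s r) + t1 + t2) s2
  | XWhileF r p s : nmem s r = 0 ->
      exec (While r p) s (bitlen (nmem s r)) s.

Lemma exec_det p s t s' : exec p s t s' ->
  forall t1 s1, exec p s t1 s1 -> t1 = t /\ s1 = s'.
Proof.
elim=> {p s t s'}.
all: try by move=> *; match goal with H : exec _ _ _ _ |- _ => inversion H end.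
- move=> p1 p2 s ta sa tb sb _ IH1 _ IH2 t1 s1 H; inversion H; subst.
  match goal with Ha : exec p1 _ _ _, Hb : exec p2 _ _ _ |- _ =>
    by have [? ?] := IH1 _ _ Ha; subst; have [-> ->] := IH2 _ _ Hb end.
- move=> r p1 p2 s ta sa nz _ IH t1 s1 H; inversion H; subst.
    match goal with Ha : exec p1 _ _ _ |- _ =>
      by have [-> ->] := IH _ _ Ha end.
  by exfalso; move/eqP: nz.
- move=> r p1 p2 s ta sa z0 _ IH t1 s1 H; inversion H; subst.
    by exfalso; match goal with K : is_true (_ != _) |- _ => move/eqP: K end.
  match goal with Ha : exec p2 _ _ _ |- _ =>
    by have [-> ->] := IH _ _ Ha end.
- move=> r p s ta sa tb sb nz _ IH1 _ IH2 t1 s1 H; inversion H; subst.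
    match goal with Ha : exec p _ _ _, Hb : exec (While _ _) _ _ _ |- _ =>
      by have [? ?] := IH1 _ _ Ha; subst; have [-> ->] := IH2 _ _ Hb end.
  by exfalso; move/eqP: nz.
- move=> r p s z0 t1 s1 H; inversion H; subst => //.
  by exfalso; match goal with K : is_true (_ != _) |- _ => move/eqP: K end.
Qed.

End Semantics.

Record instance (m mu : nat) := Instance {
  in_F : finFieldType;
  in_field : field_construction in_F (2 * m + 1);
  in_omega : {unit in_F};
  in_omegaP : generator [set: {unit in_F}] in_omega;
  in_gT : finGroupType;
  in_U : {group in_gT};
  in_bb : blackbox in_U mu;
  in_X : seq (bb_string in_bb);
  in_G : {group in_gT};
  in_x : bb_string in_bb;
  in_y : bb_string in_bb;
  in_z : bb_string in_bb;
  in_g : bb_string in_bb;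
  in_X_valid : forall s, s \in in_X -> bb_valid s;
  in_x_valid : bb_valid in_x;
  in_y_valid : bb_valid in_y;
  in_z_valid : bb_valid in_z;
  in_g_valid : bb_valid in_g;
  in_GE : in_G = <<[set bb_elt s | s in in_X]>>%G;
  in_G_sub : in_G \subset in_U;
  in_G_simple : simple in_G;
  in_G_isog : in_G \isog Sz m in_omega;
  in_std : standard_generators m in_omega in_G
             (bb_elt in_x) (bb_elt in_y) (bb_elt in_z)
}.

Section Inputs.
Variables (m mu : nat) (I : instance m mu).

(* Unused cells hold 0, respectively the string of x. *)
Definition initial_state : state (in_bb I) :=
  State
    (nth 0 [:: m; fc_modulus (in_field I);
               fc_code (in_field I) (FinRing.uval (in_omega I));
               size (in_X I)])
    (nth (in_x I) [:: in_x I, in_y I, in_z I, in_g I & in_X I])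
    [::].

Definition runs (p : prog) (t : nat) (s : state (in_bb I)) : Prop :=
  exec p initial_state t s.

Definition in_Y : seq (in_gT I) :=
  [:: bb_elt (in_x I); bb_elt (in_y I); bb_elt (in_z I)].

(* The answer to the membership question is read in n[0]. *)
Definition accepts (s : state (in_bb I)) : bool := nmem s 0 != 0.

End Inputs.

Definition solves_membership (p : prog) : Prop :=
  forall (m mu : nat) (I : instance m mu), 0 < m ->
  exists (t : nat) (s : state (in_bb I)),
    [/\ runs p t s,
        accepts s = (bb_elt (in_g I) \in in_G I) &
        bb_elt (in_g I) \in in_G I ->
          slp_value (in_Y I) (tape s) = Some (bb_elt (in_g I))].

Definition worst_case_time (p : prog) (m mu T : nat) : Prop :=
  (forall (I : instance m mu) t s, @runs m mu I p t s -> t <= T) /\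
  (exists (I : instance m mu) t s, @runs m mu I p t s /\ t = T).

Definition time_Theta (p : prog) (f : nat -> nat -> nat) : Prop :=
  exists c C : nat, forall m mu : nat, 0 < m -> inhabited (instance m mu) ->
  exists T : nat,
    [/\ worst_case_time p m mu T, f m mu <= c * T & T <= C * f m mu].

Definition slp_length_O (p : prog) (f : nat -> nat) : Prop :=
  exists C : nat, forall (m mu : nat) (I : instance m mu) t s, 0 < m ->
    @runs m mu I p t s -> accepts s -> slp_length (tape s) <= C * f m.

(* Main.v *)
(* Write j = x^2, t_i = x^(y^i) and v_i = x^i j^(y^i), where a^b = b^-1 a b. The
   centraliser C(j) is the Sylow 2-subgroup of order q^2 fixing the same point
   of the ovoid as j. It acts freely on the conjugates of j^z (sharply
   transitively on the other points), and each of its elements is v_k t_i for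
   some i and k: conjugation of x by the elements of C(j) determines them up to
   C(x) = { v_k }. As the orders 4 of x and q - 1 of y are coprime, both families
   are exhausted by i < 4(q - 1).

   Five loops of that length, each with boundedly many oracle calls per round,
   decompose g. First find h = y^e with (j (j^h)^g)^5 = 1: by the Bruhat
   decomposition this normalises the torus part, so that c = (j^h)^g is j or
   (j^z)^u with u in C(j). In the second case c^(x^u) = j^c, because
   (j^z)^x = j^(j^z) already holds over the prime field; this equation, being
   satisfied by no other element of C(j) in place of x^u, finds t with
   x^t = x^u, and then (j^z)^(v t) = c finds v with u = v t. Now
   g' = h g u^-1 z (or h g u^-1 if c = j) is in C(j), and is written as v' t' by
   two more loops. No field arithmetic is needed. The powers of y in the answer
   make it an SLP with boundedly many cells, each of length O(log q).

   There are at least |G| > q - 1 black box strings, so mu >= 2m and the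
   arithmetic on loop counters costs O(mu) as well. *)
From Stdlib Require Import Ring Ring_theory Classical.
From mathcomp Require Import all_boot all_order all_algebra all_fingroup.
From mathcomp Require Import all_solvable all_field zify.
Require Import Defs.

Set Implicit Arguments.
Unset Strict Implicit.
Unset Printing Implicit Defensive.

Import GRing.Theory.

(** * Properties of Suzuki groups that are invariant under isomorphism *)

Section SuzukiLike.
Local Open Scope group_scope.

(* What the algorithm uses of Sz(q). Being invariant under isomorphisms, it is
   proved for matrices and transported to the black box group. *)
Record suzuki_like (gT : finGroupType) (G : {group gT}) (x y z : gT) (q : nat) :
    Prop := SuzukiLike {
  sl_x : x \in G;
  sl_y : y \in G;
  sl_z : z \in G;
  sl_order_x : #[x] = 4;
  sl_order_y : #[y] = q.-1;
  sl_zz : z * z = 1;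
  sl_j_cent : forall i, (x ^+ 2) ^ (x ^ (y ^+ i)) = x ^+ 2 /\
    (x ^+ 2) ^ ((x ^+ 2) ^ (y ^+ i)) = x ^+ 2;
  sl_jz_x : ((x ^+ 2) ^ z) ^ x = (x ^+ 2) ^ ((x ^+ 2) ^ z);
  sl_cent_j : forall u, u \in G -> (x ^+ 2) ^ u = x ^+ 2 ->
    exists i, x ^ (x ^ (y ^+ i)) = x ^ u;
  sl_cent_x : forall u, u \in G -> x ^ u = x ->
    exists i, u = x ^+ i * (x ^+ 2) ^ (y ^+ i);
  sl_order5 : forall g, g \in G ->
    exists i, ((x ^+ 2) * ((x ^+ 2) ^ (y ^+ i)) ^ g) ^+ 5 = 1;
  sl_order5_inv : forall g, g \in G -> ((x ^+ 2) * (x ^+ 2) ^ g) ^+ 5 = 1 ->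
    (x ^+ 2) ^ g = x ^+ 2 \/
    exists2 u, u \in G & (x ^+ 2) ^ u = x ^+ 2 /\
      (x ^+ 2) ^ g = ((x ^+ 2) ^ z) ^ u;
  sl_free : forall u, u \in G -> (x ^+ 2) ^ u = x ^+ 2 ->
    ((x ^+ 2) ^ z) ^ u = (x ^+ 2) ^ z -> u = 1
}.

Ltac memG G := by repeat first
  [ assumption | apply (group1 G)
  | apply (@groupX _ G) | apply (@groupJ _ G) | apply (@groupM _ G)].

Ltac morphG G f := repeat first
  [ rewrite (morphX f); [| memG G]
  | rewrite (morphJ f); [| memG G | memG G]
  | rewrite (morphM f); [| memG G | memG G]].

Lemma suzuki_like_isom (gT hT : finGroupType) (G : {group gT}) (H : {group hT})
    (f : {morphism G >-> hT}) (x y z : gT) (q : nat) :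
    isom G H f -> x \in G -> y \in G -> z \in G ->
  suzuki_like H (f x) (f y) (f z) q -> suzuki_like G x y z q.
Proof.
move=> /isomP[injf imf] xG yG zG [_ _ _ ox oy zz jc jzx cj cx o5 o5i fr].
have fG u : u \in G -> f u \in H by move=> uG; rewrite -imf mem_morphim.
have fI u v : u \in G -> v \in G -> f u = f v -> u = v.
  by move=> uG vG; apply: (injmP injf).
have f1 : f 1 = 1 by rewrite morph1.
split=> //.
- by rewrite -ox order_injm.
- by rewrite -oy order_injm.
- by apply: fI; [memG G | memG G | rewrite f1; morphG G f].
- move=> i; have [j1 j2] := jc i.
  by split; (apply: fI; [memG G | memG G | morphG G f]).
- by apply: fI; [memG G | memG G | morphG G f].
- move=> u uG ju.
  have [||i e] := cj (f u); first exact: fG.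
    by transitivity (f ((x ^+ 2) ^ u)); [morphG G f | rewrite ju; morphG G f].
  by exists i; apply: fI; [memG G | memG G | morphG G f].
- move=> u uG xu.
  have [||i e] := cx (f u); first exact: fG.
    by transitivity (f (x ^ u)); [morphG G f | rewrite xu].
  by exists i; apply: fI; [memG G | memG G | morphG G f].
- move=> g gG; have [|i e] := o5 (f g); first exact: fG.
  by exists i; apply: fI; [memG G | memG G | rewrite f1; morphG G f].
- move=> g gG e.
  have [||e1|[u uH [ju e1]]] := o5i (f g).
  + exact: fG.
  + by transitivity (f ((x ^+ 2 * (x ^+ 2) ^ g) ^+ 5)); [morphG G f | rewrite e f1].
  + by left; apply: fI; [memG G | memG G | morphG G f].
  move: uH ju e1; rewrite -imf => /morphimP[v vG _ ->] ju e1.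
  by right; exists v => //; split; (apply: fI; [memG G | memG G | morphG G f]).
- move=> u uG ju jzu; apply: fI; [memG G | memG G | rewrite f1].
  apply: fr; first exact: fG.
    by transitivity (f ((x ^+ 2) ^ u)); [morphG G f | rewrite ju; morphG G f].
  by transitivity (f (((x ^+ 2) ^ z) ^ u)); [morphG G f | rewrite jzu; morphG G f].
Qed.

End SuzukiLike.

(** * The matrix groups *)

Section SuzukiMatrices.
Local Open Scope ring_scope.
Variables (F : finFieldType) (m : nat) (omega : {unit F}).
Hypotheses (m_gt0 : (0 < m)%N) (cardF : #|F| = (2 ^ (2 * m + 1))%N).
Hypothesis omega_gen : generator [set: {unit F}] omega.

(** * Characteristic 2 and the automorphism [twist] *)

Let F2 : 2 \in [pchar F].
Proof. exact: card_finPcharP cardF _. Qed.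

Let K : Type := F.
Let K0 : K := 0 : F.
Let K1 : K := 1 : F.
Let Kadd (a b : K) : K := (a : F) + (b : F).
Let Kmul (a b : K) : K := (a : F) * (b : F).
Let Kinv (a : K) : K := (a : F)^-1.

Let bool_to_K (b : bool) : K := if b then K1 else K0.

Let K_ring : ring_theory K0 K1 Kadd Kmul Kadd id (@eq K).
Proof.
split=> //; [exact: add0r|exact: addrC|exact: addrA|exact: mul1r|exact: mulrC
  |exact: mulrA|exact: mulrDl|exact: addrr_pchar2].
Qed.

Let K_morph : ring_morph K0 K1 Kadd Kmul Kadd id (@eq K)
    false true addb andb addb id eqb bool_to_K.
Proof.
split=> //.
- by case=> [] [] /=; rewrite /Kadd /K0 /K1 ?addrr_pchar2 ?addr0 ?add0r.
- by case=> [] [] /=; rewrite /Kadd /K0 /K1 ?addrr_pchar2 ?addr0 ?add0r.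
- by case=> [] [] /=; rewrite /Kmul /K0 /K1 ?mulr1 ?mulr0.
- by move=> x y /eqP->.
Qed.

(* [ring] finds the ring from the type of the left-hand side: it must not be a
   variable of type [F]. *)
Let K_eq (a b : K) : Kadd a K0 = Kadd b K0 -> a = b.
Proof. by rewrite /Kadd !addr0. Qed.

Ltac bool_cst t :=
  match t with
  | K0 => constr:(false)
  | K1 => constr:(true)
  | _ => constr:(InitialRing.NotConstant)
  end.

Add Ring K_ring : K_ring (morphism K_morph, constants [bool_cst]).

(* [ring] modulo 2. *)
Ltac ring2 :=
  rewrite ?expr2;
  repeat match goal with
  | |- context [@GRing.add ?V ?a ?b] => change (@GRing.add V a b) with (Kadd a b)
  | |- context [@GRing.mul ?V ?a ?b] => change (@GRing.mul V a b) with (Kmul a b)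
  | |- context [@GRing.inv ?V ?a] => change (@GRing.inv V a) with (Kinv a)
  | |- context [@GRing.zero ?V] => change (@GRing.zero V) with K0
  | |- context [@GRing.one ?V] => change (@GRing.one V) with K1
  end;
  match goal with |- @eq _ ?a ?b => apply: (K_eq (a := a) (b := b)) end; ring.

(* The automorphism whose square is the Frobenius map. *)
Definition twist (a : F) : F := a ^+ suzt m.
Local Notation th := twist.

Lemma twistM a b : th (a * b) = th a * th b.
Proof. exact: exprMn. Qed.

Lemma twistD a b : th (a + b) = th a + th b.
Proof.
by apply: exprDn_pchar; apply/pnatP=> [|p pr_p]; rewrite /suzt ?expn_gt0 //
  Euclid_dvdX // dvdn_prime2 // => /andP[/eqP-> _].
Qed.

Lemma twistX a n : th (a ^+ n) = th a ^+ n.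
Proof. by rewrite /twist -!exprM mulnC. Qed.

Lemma twist0 : th 0 = 0.
Proof. by rewrite /twist expr0n /suzt expn_eq0. Qed.

Lemma twist1 : th 1 = 1.
Proof. exact: expr1n. Qed.

Lemma twistV a : th a^-1 = (th a)^-1.
Proof. by rewrite /twist exprVn. Qed.

(** The square of [suzt m] is [#|F| * 2], and [a ^+ #|F| = a]. *)
Lemma twistK a : th (th a) = a * a.
Proof.
rewrite /twist -exprM.
have ->: (suzt m * suzt m = #|F| * 2)%N.
  by rewrite cardF /suzt -expnD -expnSr; congr (2 ^ _)%N; lia.
by rewrite exprM expf_card expr2.
Qed.

Lemma sqr_inj (a b : F) : a * a = b * b -> a = b.
Proof.
move=> ab; apply/eqP; rewrite -subr_eq0 (oppr_pchar2 F2).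
suff: (a + b) * (a + b) == 0 by rewrite mulf_eq0 orbb.
have ->: (a + b) * (a + b) = a * a + b * b by ring2.
by rewrite ab; apply/eqP; ring2.
Qed.

Lemma twist_inj : injective th.
Proof. by move=> a b /(congr1 th); rewrite !twistK => /sqr_inj. Qed.

Lemma twist_eq0 a : (th a == 0) = (a == 0).
Proof. by rewrite -[RHS](inj_eq twist_inj) twist0. Qed.

Lemma twist_fixed a : th a = a -> a = 0 \/ a = 1.
Proof.
move=> ta; have := twistK a; rewrite !ta => /esym/eqP.
rewrite -{3}[a]mulr1 -subr_eq0 -mulrBr mulf_eq0 subr_eq0.
by case/orP=> /eqP->; [left | right].
Qed.

Lemma add_eq0_char2 (a b : F) : (a + b == 0) = (a == b).
Proof. by rewrite -[RHS]subr_eq0 (oppr_pchar2 F2). Qed.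

(* A polynomial of degree suzt m + 2, which is less than #|F| as m > 0. *)
Lemma sparse_poly_eq0 (c1 c2 c3 : F) :
    (forall b, c1 * (b * b * th b) + c2 * th b + c3 * (b * b) = 0) ->
  [/\ c1 = 0, c2 = 0 & c3 = 0].
Proof.
move=> c0; pose t := suzt m.
(* Here [m > 0] keeps the exponents [t] and 2 apart. *)
have t_gt2 : (2 < t)%N by rewrite /t /suzt (@ltn_exp2l 2 1).
pose p : {poly F} := c1 *: 'X^((t + 2)%N) + c2 *: 'X^t + c3 *: 'X^2.
have pE b : p.[b] = c1 * (b * b * th b) + c2 * th b + c3 * (b * b).
  by rewrite !(hornerD, hornerZ, hornerXn) exprD expr2 [_ ^+ t * _]mulrC.
have coefp i : p`_i = c1 * (i == (t + 2)%N)%:R + c2 * (i == t)%:R + c3 * (i == 2)%:R.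
  by rewrite !coefE.
have p0 : p = 0.
  apply/eqP/negPn/negP => /max_poly_roots/(_ _ (enum_uniq F)).
  have -> : all (root p) (enum F).
    by apply/allP=> b _; rewrite rootE pE c0.
  move=> /(_ isT); rewrite -cardE cardF ltnNge; case/negP.
  have: (size p <= t.+3)%N.
    apply/leq_sizeP=> i lti; rewrite coefp.
    by rewrite !gtn_eqF ?mulr0 ?addr0 //; lia.
  move/leq_trans; apply; rewrite /t /suzt addn1 mul2n -addnn -addnS expnD.
  have: (2 <= 2 ^ m)%N by rewrite (@leq_exp2l 2 1).
  have: (4 <= 2 ^ m.+1)%N by rewrite (@leq_exp2l 2 2).
  move: (2 ^ m)%N (2 ^ m.+1)%N => u v; nia.
have := coefp 2; have := coefp t; have := coefp (t + 2)%N.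
rewrite p0 !coef0 !eqxx.
have [-> -> ->] : [/\ (t + 2)%N == t = false, (t + 2)%N == 2 = false & t == 2 = false]%N.
  by split; apply/eqP; lia.
have [-> -> ->] : [/\ t == (t + 2)%N = false, 2 == (t + 2)%N = false & 2 == t = false]%N.
  by split; apply/eqP; lia.
by rewrite !mulr0 !mulr1 !add0r !addr0 => <- <- <-.
Qed.

(** * Row vectors and the unipotent matrices *)

Definition row4 (a b c d : F) : 'rV[F]_4 := \row_j nth 0 [:: a; b; c; d] j.
Arguments row4 (a b c d)%_ring_scope.

Lemma row4P (v : 'rV[F]_4) : exists a b c d, v = row4 a b c d.
Proof.
exists (v 0 (inord 0)), (v 0 (inord 1)), (v 0 (inord 2)), (v 0 (inord 3)).
apply/rowP=> -[[|[|[|[|i]]]] hi] //; rewrite mxE /=;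
  by congr (v 0 _); apply/val_inj; rewrite /= inordK.
Qed.

Lemma row4_inj a b c d a' b' c' d' :
  row4 a b c d = row4 a' b' c' d' -> [/\ a = a', b = b', c = c' & d = d'].
Proof.
move/rowP=> e; split.
- by have:= e (@Ordinal 4 0 isT); rewrite !mxE.
- by have:= e (@Ordinal 4 1 isT); rewrite !mxE.
- by have:= e (@Ordinal 4 2 isT); rewrite !mxE.
- by have:= e (@Ordinal 4 3 isT); rewrite !mxE.
Qed.

Lemma row4Z l a b c d : l *: row4 a b c d = row4 (l * a) (l * b) (l * c) (l * d).
Proof. by apply/rowP=> -[[|[|[|[|i]]]] hi] //; rewrite !mxE. Qed.

Lemma row4D a b c d a' b' c' d' :
  row4 a b c d + row4 a' b' c' d' = row4 (a + a') (b + b') (c + c') (d + d').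
Proof. by apply/rowP=> -[[|[|[|[|i]]]] hi] //; rewrite !mxE. Qed.

(** Matrix identities are tested on a generic row, which turns each into four polynomial identities
    for [ring2]. *)
Lemma mx4_ext (A B : 'M[F]_4) :
  (forall a b c d, row4 a b c d *m A = row4 a b c d *m B) -> A = B.
Proof.
move=> AB; apply/row_matrixP=> i; rewrite !rowE.
by have [a [b [c [d ->]]]] := row4P (delta_mx 0 i).
Qed.

(* The first coordinate of the ovoid point (snorm a b, b, a, 1). *)
Definition snorm a b := a * a * th a + a * b + th b.

(** These matrices form the Sylow 2-subgroup. The last row, the image of [row4 0 0 0 1], is the
    ovoid point with parameters [a] and [b + a * th a]. *)
Definition unip_mx a b : 'M[F]_4 := mx4
  [:: [:: 1; 0; 0; 0];
      [:: a; 1; 0; 0];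
      [:: b; th a; 1; 0];
      [:: snorm a b; a * th a + b; a; 1]].

Lemma row4_unip_mx v1 v2 v3 v4 a b : row4 v1 v2 v3 v4 *m unip_mx a b =
  row4 (v1 + v2 * a + v3 * b + v4 * snorm a b)
     (v2 + v3 * th a + v4 * (a * th a + b)) (v3 + v4 * a) v4.
Proof.
apply/rowP=> -[[|[|[|[|i]]]] hi] //;
  rewrite !mxE !big_ord_recl big_ord0 !mxE /=; ring2.
Qed.

Lemma row4_zhat_mx v1 v2 v3 v4 : row4 v1 v2 v3 v4 *m zhat_mx F = row4 v4 v3 v2 v1.
Proof.
apply/rowP=> -[[|[|[|[|i]]]] hi] //;
  rewrite !mxE !big_ord_recl big_ord0 !mxE /=; ring2.
Qed.

Lemma row4_diag v1 v2 v3 v4 d1 d2 d3 d4 :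
  row4 v1 v2 v3 v4 *m diag_mx (row4 d1 d2 d3 d4) =
  row4 (v1 * d1) (v2 * d2) (v3 * d3) (v4 * d4).
Proof. by apply/rowP=> -[[|[|[|[|i]]]] hi] //; rewrite mul_mx_diag !mxE. Qed.

Lemma unip_mx_unit a b : unip_mx a b \is a GRing.unit.
Proof.
have trigx : is_trig_mx (unip_mx a b).
  by apply/is_trig_mxP=> -[[|[|[|[|i]]]] hi] -[[|[|[|[|j]]]] hj] //= _;
    rewrite mxE.
by rewrite -[_ \is a _]/(_ \in unitmx) unitmxE (det_trig trigx)
  !big_ord_recl big_ord0 !mxE /= !mulr1 unitr1.
Qed.

(* Group operations are elaborated over this abbreviation: with the several
   instance paths from {'GL_4[F]} unification unfolds matrix products. *)
Let GLT : finGroupType := {'GL_4[F]}.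

Definition unip a b : GLT := FinRing.unit _ (unip_mx_unit a b).
Arguments unip (a b)%_ring_scope.

Let x : GLT := xhat F.
Let y : GLT := yhat m omega.
Let z : GLT := zhat F.

Lemma xhatE : x = unip 1 1.
Proof.
apply/val_inj/matrixP=> -[[|[|[|[|i]]]] hi] -[[|[|[|[|j]]]] hj] //;
  by rewrite !mxE //= /snorm !twist1; ring2.
Qed.

Lemma row4_unip v1 v2 v3 v4 a b : row4 v1 v2 v3 v4 *m val (unip a b) =
  row4 (v1 + v2 * a + v3 * b + v4 * snorm a b)
     (v2 + v3 * th a + v4 * (a * th a + b)) (v3 + v4 * a) v4.
Proof. exact: row4_unip_mx. Qed.

Lemma row4_z v1 v2 v3 v4 : row4 v1 v2 v3 v4 *m val z = row4 v4 v3 v2 v1.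
Proof. exact: row4_zhat_mx. Qed.

Lemma row4_y v1 v2 v3 v4 : row4 v1 v2 v3 v4 *m val y = row4 v1 v2 v3 v4 *m yhat_mx m omega.
Proof. by []. Qed.

Local Opaque unip xhat yhat zhat.

Lemma GL_row4_inj (g h : GLT) :
  (forall a b c d, row4 a b c d *m val g = row4 a b c d *m val h) -> g = h.
Proof. by move/mx4_ext/(@val_inj _ _ {'GL_4[F]}). Qed.

Lemma row_mulg (v : 'rV[F]_4) (g h : GLT) :
  v *m val (g * h)%g = v *m val g *m val h.
Proof. by rewrite FinRing.val_unitM mulmxA. Qed.

Lemma row_mul1g (v : 'rV[F]_4) : v *m val (1%g : GLT) = v.
Proof. exact: mulmx1. Qed.

(** The cocycle [th a * c] vanishes when [a] or [c] is 0, so the elements [unip 0 c] are central. *)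
Lemma unipM a b c d : (unip a b * unip c d)%g = unip (a + c) (b + d + th a * c).
Proof.
apply: GL_row4_inj => v1 v2 v3 v4; rewrite row_mulg !row4_unip /snorm.
rewrite !(twistD, twistM, twistK).
by congr row4; ring2.
Qed.

Lemma unip00 : unip 0 0 = 1%g.
Proof.
apply: GL_row4_inj => v1 v2 v3 v4; rewrite row_mul1g row4_unip /snorm !twist0.
by congr row4; ring2.
Qed.

Lemma unipV a b : (unip a b)^-1%g = unip a (b + a * th a).
Proof.
apply: (mulgI (unip a b)); rewrite mulgV unipM -unip00.
by congr unip; ring2.
Qed.

Lemma unip_inj a b c d : unip a b = unip c d -> a = c /\ b = d.
Proof.
move/(congr1 (fun g => row4 0 0 1 0 *m val g)); rewrite !row4_unip.
case/row4_inj; rewrite !mul0r !mul1r !addr0 !add0r => -> tac _ _.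
by rewrite (twist_inj tac).
Qed.

(** * The torus and its action on the unipotent elements *)

Let w : F := FinRing.uval omega.
Let k : F := w ^+ (suzt m)./2.

Lemma omega_neq0 : w != 0.
Proof. by rewrite -unitfE; apply: (valP omega). Qed.

Lemma half_suzt : (suzt m)./2 = (2 ^ m)%N.
Proof. by rewrite /suzt expnS mul2n doubleK. Qed.

(** The exponents multiply to [2 ^ (2 * m + 1) = #|F|]. Torus computations then need only the
    letters [k] and [w], on which [twist] acts by simple rules. *)
Lemma twist_k : th k = w.
Proof.
rewrite /twist /k half_suzt -exprM -expnD.
by have ->: (m + m.+1 = 2 * m + 1)%N by [lia]; rewrite -cardF expf_card.
Qed.

Lemma k_neq0 : k != 0.
Proof. by rewrite expf_neq0 // omega_neq0. Qed.

Lemma nz_omega_exp a : a != 0 -> exists i, a = w ^+ i.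
Proof.
move=> a0; have ua : a \is a GRing.unit by rewrite unitfE.
have: FinRing.unit F ua \in <[omega]>%g.
  by have /eqP <- : [set: {unit F}] == <[omega]>%g := omega_gen; rewrite inE.
by case/cycleP=> i /(congr1 val); rewrite FinRing.val_unitX; exists i.
Qed.

Lemma nz_k_exp a : a != 0 -> exists i, a = k ^+ i.
Proof.
rewrite -twist_eq0 => /nz_omega_exp[i ai]; exists i; apply: twist_inj.
by rewrite ai twistX twist_k.
Qed.

Lemma yhat_mxE : yhat_mx m omega = diag_mx (row4 (k * w) k k^-1 (k * w)^-1).
Proof. by rewrite /k -exprSr. Qed.

Lemma row4_yX i v1 v2 v3 v4 : row4 v1 v2 v3 v4 *m val (y ^+ i)%g =
  row4 (v1 * (k * w) ^+ i) (v2 * k ^+ i) (v3 * k ^- i) (v4 * (k * w) ^- i).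
Proof.
elim: i v1 v2 v3 v4 => [|i IH] v1 v2 v3 v4.
  by rewrite expg0 row_mul1g !expr0 invr1 !mulr1.
rewrite expgSr row_mulg IH row4_y yhat_mxE row4_diag.
by rewrite -!mulrA -!exprVn -!exprSr.
Qed.

Lemma twist_omega : th w = k * k.
Proof. by rewrite -twist_k twistK. Qed.

(** As [th w = k * k] and [th k = w], all three terms of [snorm] have the same weight under the
    torus. *)
Lemma snorm_scale a b : snorm (a * w) (b * (k * k * w)) =
  k * w * (k * w * snorm a b).
Proof.
rewrite /snorm !(twistD, twistM) !twist_k !twist_omega; ring2.
Qed.

Lemma unipJ_y a b : (unip a b ^ y)%g = unip (a * w) (b * (k * k * w)).
Proof.
suff e : (unip a b * y = y * unip (a * w) (b * (k * k * w)))%g.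
  by rewrite conjgE e mulKg.
apply: GL_row4_inj => v1 v2 v3 v4; rewrite -[y]expg1 !row_mulg row4_unip !row4_yX row4_unip !expr1.
have k0 := k_neq0; have kw0 : k * w != 0 by rewrite mulf_neq0 ?omega_neq0.
have tE : th (a * w) = k * (k * th a) by rewrite twistM twist_omega; ring2.
rewrite snorm_scale tE.
have e1 : b * (k * k * w) = k * (k * (w * b)) by ring2.
have e2 : a * w * (k * (k * th a)) + b * (k * k * w) =
  k * w * (k * (a * th a + b)) by ring2.
have e3 v : v / (k * w) * (a * w) = v * a / k.
  transitivity (v * a / k * (w / w)); first by rewrite invfM; ring2.
  by rewrite mulfV ?omega_neq0 ?mulr1.
have cK u : (k * w)^-1 * (k * (w * u)) = u by rewrite [k * (w * u)]mulrA mulKf.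
rewrite e2 e1 e3 -!mulrA !mulKf // !cK.
by congr row4; ring2.
Qed.

Lemma unipJ_yX a b i : (unip a b ^ (y ^+ i))%g = unip (a * w ^+ i) (b * (k * k * w) ^+ i).
Proof.
elim: i => [|i IH]; first by rewrite expg0 conjg1 !expr0 !mulr1.
by rewrite expgSr conjgM IH unipJ_y !exprSr !mulrA.
Qed.

(** * The form, the ovoid and the Bruhat decomposition *)

(** The symplectic form; as signs vanish in characteristic 2, its Gram matrix is [zhat_mx]
    itself. *)
Definition frm (u v : 'rV[F]_4) : F := (u *m zhat_mx F *m v^T) 0 0.

Lemma frm_rv a b c d a' b' c' d' :
  frm (row4 a b c d) (row4 a' b' c' d') = a * d' + b * c' + c * b' + d * a'.
Proof.
by rewrite /frm row4_zhat_mx mxE !big_ord_recl big_ord0 !mxE /=; ring2.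
Qed.

(* The cone over the Suzuki-Tits ovoid. *)
Definition ovoid (v : 'rV[F]_4) : Prop := exists2 l, l != 0 &
  v = row4 l 0 0 0 \/ exists a b, v = row4 (l * snorm a b) (l * b) (l * a) l.

(** A substitute for membership in [Sz m omega]: it can be checked on generators and suffices for
    the Bruhat decomposition. *)
Definition geometric (g : GLT) : Prop :=
  (forall u v, frm (u *m val g) (v *m val g) = frm u v) /\
  (forall v, ovoid v -> ovoid (v *m val g)).

Lemma geometricM g h : geometric g -> geometric h -> geometric (g * h)%g.
Proof.
move=> [fg og] [fh oh]; split=> [u v|v ov]; rewrite !row_mulg ?fh ?fg //.
by apply/oh/og.
Qed.

Lemma geometric1 : geometric 1%g.
Proof. by split=> [u v|v ov]; rewrite !row_mul1g. Qed.

Lemma geometric_unip a b : geometric (unip a b).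
Proof.
split=> [u v|v [l l0 [->|[c [d ->]]]]].
- have [u1 [u2 [u3 [u4 ->]]]] := row4P u; have [v1 [v2 [v3 [v4 ->]]]] := row4P v.
  by rewrite !row4_unip !frm_rv; ring2.
- by exists l => //; left; rewrite row4_unip; congr row4; ring2.
- exists l => //; right; exists (c + a), (d + c * th a + (a * th a + b)).
  rewrite row4_unip /snorm !(twistD, twistM, twistK).
  by congr row4; ring2.
Qed.

(** The matrix [z] moves [snorm a b] to the last coordinate, which must be nonzero. If [a != 0],
    division by [a * a * th a] leaves [1 + c + th c = 0]. Then [th c = 1 + c], so
    [c * c = th (th c) = c], but neither 0 nor 1 is a solution. *)
Lemma snorm_neq0 a b : (a != 0) || (b != 0) -> snorm a b != 0.
Proof.
apply: contraTneq => N0; rewrite negb_or !negbK.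
have a0 : a = 0.
  apply/eqP; apply: contraTT isT => a0.
  pose c := b / (a * th a).
  have bE : b = a * th a * c by rewrite mulrC divfK // mulf_neq0 ?twist_eq0.
  have : a * a * th a * (1 + c + th c) = 0.
    rewrite -N0 /snorm bE !(twistM, twistK); ring2.
  move/eqP; rewrite !mulf_eq0 twist_eq0 (negPf a0) /= => /eqP c1.
  have tc : th c = 1 + c.
    by apply/eqP; rewrite -add_eq0_char2 -c1; apply/eqP; ring2.
  have := twistK c; rewrite tc twistD twist1 tc => cc.
  have {}cc : c * c = c by rewrite -cc; ring2.
  have: c * (c - 1) == 0 by rewrite mulrBr mulr1 cc subrr.
  rewrite mulf_eq0 subr_eq0 => /orP[] /eqP cE; move/eqP: tc; rewrite cE.
    by rewrite twist0 addr0 eq_sym oner_eq0.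
  by rewrite twist1 addrr_pchar2 // oner_eq0.
move: N0; rewrite /snorm a0 !mul0r !add0r => /eqP.
by rewrite twist_eq0 eqxx.
Qed.

(** The reversed point [(1, a, b, snorm a b)], divided by its last coordinate, must again begin with
    the norm of its parameters. *)
Lemma snorm_inv a b : snorm a b != 0 ->
  snorm (b / snorm a b) (a / snorm a b) = (snorm a b)^-1.
Proof.
move=> N0; have tN0 : th (snorm a b) != 0 by rewrite twist_eq0.
rewrite {1}/snorm !(twistM, twistV).
apply: (mulfI N0); rewrite mulfV //.
apply: (mulfI N0); apply: (mulfI tN0); rewrite mulr1.
have tN : th (snorm a b) = a * a * th a * th a + th a * th b + b * b.
  by rewrite /snorm !(twistD, twistM, twistK); ring2.
have NV := mulfV N0; have tNV := mulfV tN0.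
(* [ring2] does not cancel inverses, so the quotients equal to 1 are displayed as factors. *)
transitivity (b * b * th b * (snorm a b / snorm a b) * (snorm a b / snorm a b)
    * (th (snorm a b) / th (snorm a b))
  + a * b * th (snorm a b) * (snorm a b / snorm a b) * (snorm a b / snorm a b)
  + th a * snorm a b * snorm a b * (th (snorm a b) / th (snorm a b))).
  ring2.
rewrite NV tNV tN /snorm; ring2.
Qed.

Lemma geometric_z : geometric z.
Proof.
split=> [u v|v [l l0 [->|[a [b ->]]]]].
- have [u1 [u2 [u3 [u4 ->]]]] := row4P u; have [v1 [v2 [v3 [v4 ->]]]] := row4P v.
  by rewrite !row4_z !frm_rv; ring2.
- exists l => //; right; exists 0, 0; rewrite row4_z /snorm twist0.
  by congr row4; ring2.
have [/orP N0|] := boolP ((a != 0) || (b != 0)); last first.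
  rewrite negb_or !negbK => /andP[/eqP-> /eqP->].
  exists l => //; left; rewrite row4_z /snorm twist0.
  by congr row4; ring2.
have {}N0 := snorm_neq0 (introT orP N0).
exists (l * snorm a b); first exact: mulf_neq0.
right; exists (b / snorm a b), (a / snorm a b).
rewrite row4_z snorm_inv // mulfK //.
have e u : l * snorm a b * (u / snorm a b) = l * u.
  by rewrite [u / _]mulrC mulrA mulfK.
by rewrite !e.
Qed.

Lemma geometric_y : geometric y.
Proof.
have k0 := k_neq0; have w0 := omega_neq0.
have kw0 : k * w != 0 by rewrite mulf_neq0.
split=> [u v|v [l l0 [->|[a [b ->]]]]]; rewrite -[y]expg1.
- have [u1 [u2 [u3 [u4 ->]]]] := row4P u; have [v1 [v2 [v3 [v4 ->]]]] := row4P v.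
  rewrite !row4_yX !expr1 !frm_rv.
  transitivity (u1 * v4 * (k * w / (k * w)) + u2 * v3 * (k / k) +
    u3 * v2 * (k / k) + u4 * v1 * (k * w / (k * w))); first by ring2.
  by rewrite !mulfV // !mulr1.
- exists (l * (k * w)); first exact: mulf_neq0.
  by left; rewrite row4_yX !expr1 !mul0r.
exists (l / (k * w)); first by rewrite mulf_neq0 ?invr_neq0.
right; exists (a * w), (b * (k * k * w)).
rewrite row4_yX !expr1 snorm_scale; congr row4.
- transitivity (l * snorm a b * (k * w) * (k * w / (k * w))).
    by rewrite mulfV // mulr1.
  by ring2.
- transitivity (l * b * k * (k * w / (k * w))); first by rewrite mulfV // mulr1.
  by ring2.
- transitivity (l * a / k * (w / w)); first by rewrite mulfV // mulr1.
  by rewrite invfM; ring2.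
Qed.

Lemma geometric_Sz g : g \in Sz m omega -> geometric g.
Proof.
case/gen_prodgP=> n [c cin ->]; elim/big_ind: _ => [||i _].
- exact: geometric1.
- exact: geometricM.
have:= cin i; rewrite !inE -orbA => /or3P[]/eqP->.
- by rewrite -[xhat F]/x xhatE; apply: geometric_unip.
- exact: geometric_y.
- exact: geometric_z.
Qed.

(* The image of the ovoid points with a = 0, and of those with b = 0, gives two
   polynomial identities whose coefficients force d to be diagonal. *)
Lemma stab_two_points d l l' : geometric d ->
    row4 1 0 0 0 *m val d = row4 l 0 0 0 -> row4 0 0 0 1 *m val d = row4 0 0 0 l' ->
  exists i, d = (y ^+ i)%g.
Proof.
move=> [fd od] d1 d4.
have [c1 [p [r [c4 d2]]]] := row4P (row4 0 1 0 0 *m val d).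
have [b1 [s [p' [b4 d3]]]] := row4P (row4 0 0 1 0 *m val d).
have fE := fd (row4 _ _ _ _) (row4 _ _ _ _).
have simp := (mulr0, mul0r, addr0, add0r, mulr1, mul1r).
have ll' : l * l' = 1.
  by move: (fE 1 0 0 0 0 0 0 1); rewrite d1 d4 !frm_rv !simp.
have l0 : l != 0 by apply: contra_eq_neq ll' => ->; rewrite mul0r eq_sym oner_eq0.
have l'0 : l' != 0 by apply: contra_eq_neq ll' => ->; rewrite mulr0 eq_sym oner_eq0.
(* Invariance of the form kills the outer entries of the two middle rows, so [d] becomes block
   diagonal. *)
have c40 : c4 = 0.
  move: (fE 0 1 0 0 1 0 0 0); rewrite d1 d2 !frm_rv !simp => /eqP.
  by rewrite mulf_eq0 (negPf l0) orbF => /eqP.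
have c10 : c1 = 0.
  move: (fE 0 1 0 0 0 0 0 1); rewrite d4 d2 !frm_rv !simp => /eqP.
  by rewrite mulf_eq0 (negPf l'0) orbF => /eqP.
have b40 : b4 = 0.
  move: (fE 0 0 1 0 1 0 0 0); rewrite d1 d3 !frm_rv !simp => /eqP.
  by rewrite mulf_eq0 (negPf l0) orbF => /eqP.
have b10 : b1 = 0.
  move: (fE 0 0 1 0 0 0 0 1); rewrite d4 d3 !frm_rv !simp => /eqP.
  by rewrite mulf_eq0 (negPf l'0) orbF => /eqP.
subst c1 c4 b1 b4.
have pp : p * p' + r * s = 1.
  by move: (fE 0 1 0 0 0 0 1 0); rewrite d2 d3 !frm_rv !simp.
have dE a b c e : row4 a b c e *m val d =
    row4 (a * l) (b * p + c * s) (b * r + c * p') (e * l').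
  have -> : row4 a b c e = a *: row4 1 0 0 0 + b *: row4 0 1 0 0 +
      c *: row4 0 0 1 0 + e *: row4 0 0 0 1.
    by rewrite !row4Z !row4D; congr row4; ring2.
  rewrite !mulmxDl -!scalemxAl d1 d2 d3 d4 !row4Z !row4D.
  by congr row4; ring2.
have l'E : l' = l^-1 by apply: (mulfI l0); rewrite mulfV.
have key a b : l * l * snorm a b = snorm (l * (b * r + a * p')) (l * (b * p + a * s)).
  have ov1 : ovoid (row4 (snorm a b) b a 1).
    by exists 1; rewrite ?oner_eq0 //; right; exists a, b; congr row4; ring2.
  have:= od _ ov1; rewrite dE => -[e e0 [|[a' [b']]]] /row4_inj[e1 e2 e3 e4].
    by case/eqP: l'0; rewrite -[l']mul1r.
  have eE : e = l^-1 by rewrite -e4 mul1r.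
  by rewrite e2 e3 eE !mulVKf // -mulrA [l * snorm a b]mulrC e1 eE mulVKf.
have [r0 lp _] : [/\ l * r * (l * r) * th (l * r) = 0,
    l * l + th (l * p) = 0 & l * r * l * p = 0].
  apply: sparse_poly_eq0 => b; have := key 0 b; rewrite /snorm !twist0 !(mul0r, add0r, addr0) => e.
  rewrite -[RHS](addrr_pchar2 F2 (l * l * th b)) {2}e !(twistD, twistM); ring2.
have [_ s0 _] : [/\ l * l + l * p' * (l * p') * th (l * p') = 0,
    th (l * s) = 0 & l * p' * l * s = 0].
  apply: sparse_poly_eq0 => a; have := key a 0; rewrite /snorm !twist0 !(mul0r, mulr0, add0r, addr0) => e.
  rewrite -[RHS](addrr_pchar2 F2 (l * l * (a * a * th a))) {2}e !(twistD, twistM); ring2.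
have {}r0 : r = 0.
  move/eqP: r0; rewrite !mulf_eq0 twist_eq0 mulf_eq0 (negPf l0) /=.
  by rewrite !orbb => /eqP.
have {}s0 : s = 0.
  by move/eqP: s0; rewrite twist_eq0 mulf_eq0 (negPf l0) => /eqP.
subst r s.
rewrite mul0r addr0 in pp.
have p0 : p != 0 by apply: contra_eq_neq pp => ->; rewrite mul0r eq_sym oner_eq0.
have p'E : p' = p^-1 by apply: (mulfI p0); rewrite mulfV.
have {}lp : l * l = th l * th p by apply/eqP; rewrite -add_eq0_char2 -twistM lp.
(* In the power of [y] with [p = k ^+ i] the entry [l] is [th p * p], so the aim is [n = 1]. It
   follows from [n * n = th n]: applying [twist] once more shows that the fourth power of [n] equals
   its square. *)
pose n := l / (th p * p).
have tp0 : th p != 0 by rewrite twist_eq0.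
have lE : l = n * (th p * p) by rewrite divfK // mulf_neq0.
have n0 : n != 0 by apply: contraNneq l0 => n0; rewrite lE n0 mul0r.
have nn : n * n = th n.
  have q0 : th p * th p * p * p != 0 by rewrite !mulf_neq0.
  apply: (mulIf q0); transitivity (l * l); first by rewrite lE; ring2.
  by rewrite lp lE !twistM twistK; ring2.
have n1 : n = 1.
  have := congr1 th nn; rewrite twistM twistK -nn => e.
  have /(mulfI n0) e1 : n * (n * (n * n)) = n * n by rewrite -[RHS]e; ring2.
  have /(mulfI n0) e2 : n * (n * n) = n * 1 by rewrite e1 mulr1.
  by apply: sqr_inj; rewrite e2 mulr1.
have [i pi] := nz_k_exp p0; exists i.
have li : l = (k * w) ^+ i by rewrite lE n1 mul1r pi twistX twist_k exprMn mulrC.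
apply: GL_row4_inj => v1 v2 v3 v4.
by rewrite dE row4_yX l'E p'E -li -pi !mulr0 addr0 add0r.
Qed.

(** The unipotent elements are transitive on the ovoid points other than [row4 1 0 0 0]; one of them
    reduces [g] to an element that fixes two points. *)
Lemma stab_point g l : geometric g -> row4 1 0 0 0 *m val g = row4 l 0 0 0 ->
  exists i a b, g = (y ^+ i * unip a b)%g.
Proof.
move=> gg g1; have [fg og] := gg.
have ov4 : ovoid (row4 0 0 0 1).
  exists 1; rewrite ?oner_eq0 //; right; exists 0, 0.
  by rewrite /snorm twist0; congr row4; ring2.
have [l' l'0 [g4|[a [b g4]]]] := og _ ov4.
  have := fg (row4 1 0 0 0) (row4 0 0 0 1); rewrite g1 g4 !frm_rv.
  by rewrite !(mul0r, mulr0, addr0, mulr1) => /eqP; rewrite eq_sym oner_eq0.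
(* This shift makes the last row of [unip a b'] the point with parameters [a] and [b]. *)
pose b' := b + a * th a.
have g4' : row4 0 0 0 1 *m val g = row4 0 0 0 l' *m val (unip a b').
  rewrite g4 row4_unip /b' /snorm !(twistD, twistM, twistK).
  by congr row4; ring2.
have [|||i dE] := @stab_two_points (g * (unip a b')^-1)%g l l'.
- by rewrite unipV; apply: geometricM => //; apply: geometric_unip.
- by rewrite row_mulg g1 unipV row4_unip; congr row4; ring2.
- by rewrite row_mulg g4' -row_mulg mulgV row_mul1g.
by exists i, a, b'; rewrite -dE mulgKV.
Qed.

Lemma zhat_sqr : (z * z = 1)%g.
Proof. by apply: GL_row4_inj => v1 v2 v3 v4; rewrite row_mulg row_mul1g !row4_z. Qed.

(** If [g] moves the point [row4 1 0 0 0], a unipotent element takes the image to [row4 0 0 0 1] and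
    [z] takes it back, so that [stab_point] applies to the product. *)
Lemma bruhat g : geometric g ->
  (exists i a b, g = (y ^+ i * unip a b)%g) \/
  (exists i a b c d, g = (y ^+ i * unip a b * z * unip c d)%g).
Proof.
move=> gg; have [fg og] := gg.
have ov1 : ovoid (row4 1 0 0 0) by exists 1; rewrite ?oner_eq0 //; left.
have [l l0 [g1|[a [b g1]]]] := og _ ov1.
  by left; apply: stab_point gg g1.
right; pose b' := b + a * th a.
have gS : row4 1 0 0 0 *m val g = row4 0 0 0 l *m val (unip a b').
  rewrite g1 row4_unip /b' /snorm !(twistD, twistM, twistK).
  by congr row4; ring2.
have [||i [c [d dE]]] := @stab_point (g * (unip a b')^-1 * z)%g l.
- apply: geometricM; last exact: geometric_z.
  by rewrite unipV; apply: geometricM => //; apply: geometric_unip.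
- by rewrite !row_mulg gS -row_mulg mulgV row_mul1g row4_z.
exists i, c, d, a, b'.
by rewrite -dE -[(g * _ * z * z)%g]mulgA zhat_sqr mulg1 mulgKV.
Qed.

(** * Centralisers and products of two involutions *)

Let j := (x ^+ 2)%g.

Lemma xhat_sqr : j = unip 0 1.
Proof.
by rewrite /j expgS expg1 xhatE unipM twist1; congr unip; ring2.
Qed.

Lemma unipJ a b c d : (unip a b ^ unip c d)%g = unip a (b + th c * a + th a * c).
Proof.
have e : (unip a b * unip c d = unip c d * unip a (b + th c * a + th a * c))%g.
  by rewrite !unipM; congr unip; ring2.
by rewrite conjgE e mulKg.
Qed.

Lemma order_xhat : #[x]%g = 4%N.
Proof.
have x4 : (#[x]%g %| 4)%N.
  rewrite order_dvdn (expgM x 2 2) -/j xhat_sqr expgS expg1 unipM -unip00; apply/eqP.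
  by congr unip; rewrite ?twist0; ring2.
have : ~~ (#[x]%g %| 2)%N.
  rewrite order_dvdn -/j xhat_sqr -unip00; apply/eqP => /unip_inj[_ /eqP].
  by rewrite oner_eq0.
have x_le4 := dvdn_leq (isT : 0 < 4)%N x4.
by move: x_le4 x4; case: #[x]%g => [|[|[|[|[|]]]]].
Qed.

Lemma kkw_exp_neq0 i : (k * k * w) ^+ i != 0.
Proof. by rewrite expf_neq0 // !mulf_neq0 ?k_neq0 ?omega_neq0. Qed.

(** The torus acts freely on the nontrivial elements [unip 0 b]. With [p = k ^+ i] the hypothesis
    reads [p * p * th p = 1]; comparison with its image under [twist] gives [th p = 1]. *)
Lemma kkw_exp_eq1 i : (k * k * w) ^+ i = 1 -> (y ^+ i = 1)%g.
Proof.
rewrite !exprMn -twist_k -twistX => e.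
have ki : k ^+ i = 1.
  move: (k ^+ i) (expf_neq0 i k_neq0) e => p p0 e.
  have tp0 : th p != 0 by rewrite twist_eq0.
  apply/twist_inj/(mulfI tp0)/(mulfI (mulf_neq0 p0 p0)); rewrite twist1.
  transitivity (th (p * p * th p)); first by rewrite !twistM twistK; ring2.
  by rewrite e twist1 mulr1 e.
apply: GL_row4_inj => v1 v2 v3 v4.
by rewrite row_mul1g row4_yX exprMn -[w]twist_k -twistX ki twist1 !mulr1 invr1 !mulr1.
Qed.

Lemma nz_kkw_exp b : b != 0 -> exists i, b = (k * k * w) ^+ i.
Proof.
move=> b0; have tb0 : th b != 0 by rewrite twist_eq0.
(* As [k ^+ i * k ^+ i = th (w ^+ i)], the choice [w ^+ i = th b / b] gives
   [(b * b / th b) * (th b / b) = b]. *)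
have [i ei] := nz_omega_exp (mulf_neq0 tb0 (invr_neq0 b0)).
exists i; rewrite !exprMn -ei; move/(congr1 th): (ei).
rewrite twistM twistV twistK twistX twist_omega exprMn => <-.
transitivity (b * (b / b) * (th b / th b)); last by ring2.
by rewrite !mulfV // !mulr1.
Qed.

Lemma order_yhat : #[y]%g = #|F|.-1.
Proof.
have ow : #[omega]%g = #|F|.-1.
  have /eqP oE : [set: {unit F}] == <[omega]>%g := omega_gen.
  by rewrite orderE -oE card_finField_unit.
apply/eqP; rewrite eqn_dvd; apply/andP; split.
  rewrite order_dvdn; apply/eqP/GL_row4_inj => v1 v2 v3 v4.
  have X1 (a : F) : a != 0 -> a ^+ #|F|.-1 = 1.
    move=> a0; apply: (mulfI a0); rewrite -exprS mulr1.
    by rewrite prednK ?expf_card // cardF expn_gt0.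
  rewrite row_mul1g row4_yX !X1 ?mulf_neq0 ?k_neq0 ?omega_neq0 //.
  by rewrite invr1 !mulr1.
rewrite -ow order_dvdn; apply/eqP/val_inj; rewrite FinRing.val_unitX.
have := unipJ_yX 1 0 #[y]%g; rewrite expg_order conjg1 => /unip_inj[].
by rewrite mul1r.
Qed.

Lemma xJ_yX i : (x ^ (y ^+ i))%g = unip (w ^+ i) ((k * k * w) ^+ i).
Proof. by rewrite xhatE unipJ_yX !mul1r. Qed.

Lemma jJ_yX i : (j ^ (y ^+ i))%g = unip 0 ((k * k * w) ^+ i).
Proof. by rewrite xhat_sqr unipJ_yX mul0r mul1r. Qed.

Lemma Sz_x : x \in Sz m omega.
Proof. by rewrite mem_gen // !inE eqxx. Qed.
Lemma Sz_y : y \in Sz m omega.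
Proof. by rewrite mem_gen // !inE eqxx ?orbT. Qed.
Lemma Sz_z : z \in Sz m omega.
Proof. by rewrite mem_gen // !inE eqxx ?orbT. Qed.

Lemma Sz_unip a b : unip a b \in Sz m omega.
Proof.
have center c : unip 0 c \in Sz m omega.
  have [->|/nz_kkw_exp[i ->]] := eqVneq c 0; first by rewrite unip00 group1.
  rewrite -jJ_yX; apply: groupJ; apply: groupX; [exact: Sz_x | exact: Sz_y].
have [->|/nz_omega_exp[i ->]] := eqVneq a 0; first exact: center.
have -> : unip (w ^+ i) b = (x ^ (y ^+ i) * unip 0 (b + (k * k * w) ^+ i))%g.
  by rewrite xJ_yX unipM; congr unip; ring2.
apply: groupM (center _); apply: groupJ; [exact: Sz_x | exact/groupX/Sz_y].
Qed.

(** The only ovoid point fixed by [j] is [row4 1 0 0 0], so [g] fixes it too; its torus part is then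
    trivial by [kkw_exp_eq1]. *)
Lemma cent_j g : g \in Sz m omega -> (j ^ g)%g = j -> exists a b, g = unip a b.
Proof.
move=> /geometric_Sz gg jg; have [_ og] := gg.
have ov1 : ovoid (row4 1 0 0 0) by exists 1; rewrite ?oner_eq0 //; left.
have : row4 1 0 0 0 *m val (g * unip 0 1)%g = row4 1 0 0 0 *m val (unip 0 1 * g)%g.
  by rewrite -xhat_sqr -[in LHS]jg conjgE mulKVg.
have j1 : row4 1 0 0 0 *m val (unip 0 1) = row4 1 0 0 0 by rewrite row4_unip; congr row4; ring2.
rewrite !row_mulg j1.
have [l l0 [g1 _|[a [b ->]]]] := og _ ov1; last first.
  rewrite row4_unip => /row4_inj[_ /eqP]; rewrite twist0.
  rewrite -subr_eq0 (oppr_pchar2 F2).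
  have -> : l * b + l * a * 0 + l * (0 * 0 + 1) + l * b = l by ring2.
  by rewrite (negPf l0).
have [i [a [b gE]]] := stab_point gg g1.
move: jg; rewrite gE conjgM jJ_yX unipJ xhat_sqr => /unip_inj[_].
rewrite twist0 mul0r mulr0 !addr0 => /kkw_exp_eq1 ->.
by exists a, b; rewrite mul1g.
Qed.

Lemma row4_jz c v1 v2 v3 v4 : row4 v1 v2 v3 v4 *m val (unip 0 c ^ z)%g =
  row4 v1 v2 (v3 + c * v1) (v4 + c * v2 + th c * v1).
Proof.
have zV : (z^-1 = z)%g by apply/eqP; rewrite eq_invg_mul zhat_sqr.
rewrite conjgE zV !row_mulg !row4_z row4_unip row4_z /snorm twist0.
by congr row4; ring2.
Qed.

(** The conjugate depends only on [a + th a], which does not change when 1 is added to [a]. This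
    takes care of [a = 0], which is no power of [w]. *)
Lemma conj_x_unip a b i : w ^+ i = a \/ w ^+ i = a + 1 ->
  (x ^ (x ^ (y ^+ i)))%g = (x ^ (unip a b))%g.
Proof.
move=> wi; rewrite xJ_yX xhatE !unipJ; congr unip.
by case: wi => ->; rewrite ?twistD !twist1; ring2.
Qed.

Section Facts.
Local Open Scope group_scope.
Local Notation G := (Sz m omega).

Lemma cent_j_conj_x u : u \in G -> j ^ u = j -> exists i, x ^ (x ^ (y ^+ i)) = x ^ u.
Proof.
move=> uG /(cent_j uG)[a [b ->]].
have [a0|a0] := eqVneq a 0%R.
  by exists 0%N; apply: conj_x_unip; right; rewrite a0 expr0 add0r.
by have [i ai] := nz_omega_exp a0; exists i; apply: conj_x_unip; left.
Qed.

Lemma expg_chinese r s : exists i, x ^+ i = x ^+ r /\ y ^+ i = y ^+ s.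
Proof.
have co : coprime 4 #|F|.-1.
  rewrite (coprime_pexpl _ _ (isT : 0 < 2)%N : coprime (2 ^ 2) _ = _) coprime2n.
  by rewrite cardF addn1 expnS mul2n -subn1 oddB ?double_gt0 ?expn_gt0 // odd_double.
exists (chinese 4 #|F|.-1 r s); split; apply/eqP.
  by rewrite eq_expg_mod_order order_xhat chinese_modl.
by rewrite eq_expg_mod_order order_yhat chinese_modr.
Qed.

(** Commuting with [x] forces [th a = a], so [a] is 0 or 1 and [u] is a power of [x] times some
    [unip 0 c]. *)
Lemma cent_x_factor u : u \in G -> x ^ u = x -> exists i, u = x ^+ i * j ^ (y ^+ i).
Proof.
move=> uG xu; have ju : j ^ u = j by rewrite /j conjXg xu.
have [a [b uE]] := cent_j uG ju.
have ta : th a = a.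
  move: xu; rewrite uE xhatE unipJ => /unip_inj[_ /eqP].
  rewrite -subr_eq0 (oppr_pchar2 F2) => /eqP e.
  apply/eqP; rewrite -add_eq0_char2 -{}e twist1; apply/eqP; ring2.
have main r c : u = x ^+ r * unip 0 c -> c != 0%R -> exists i, u = x ^+ i * j ^ (y ^+ i).
  move=> -> /nz_kkw_exp[s ->]; rewrite -jJ_yX; have [i [xi yi]] := expg_chinese r s.
  by exists i; rewrite xi yi.
have x0 r c : u = x ^+ r * unip 0 c -> exists i, u = x ^+ i * j ^ (y ^+ i).
  move=> e; have [c0|] := eqVneq c 0%R; last exact: main e.
  (* No conjugate of [j] is trivial, so for [c = 0] the involution [j] is inserted twice, once as
     [x ^+ 2]. *)
  apply: (main (r + 2)%N 1%R); last exact: oner_neq0.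
  rewrite e c0 expgD -/j xhat_sqr -mulgA unipM; congr (_ * unip _ _); rewrite ?twist0; ring2.
case: (twist_fixed ta) => a1.
  by apply: (x0 0%N b); rewrite uE a1 expg0 mul1g.
by apply: (x0 1%N (b + 1)%R); rewrite uE a1 expg1 xhatE unipM; congr unip; ring2.
Qed.

Lemma unip0_sqr c : unip 0 c * unip 0 c = 1.
Proof. by rewrite unipM -unip00 twist0; congr unip; ring2. Qed.

(* The existential hides the conjugation, which [row_mulg] would unfold. *)
Lemma jz_rows c : exists d : GLT, d = unip 0 c ^ z /\
  forall v1 v2 v3 v4, row4 v1 v2 v3 v4 *m val d =
    row4 v1 v2 (v3 + c * v1)%R (v4 + c * v2 + th c * v1)%R.
Proof. by exists (unip 0 c ^ z); split=> // *; apply: row4_jz. Qed.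

Lemma jz_order5 : (j * j ^ z) ^+ 5 = 1.
Proof.
rewrite xhat_sqr; have [d [<- rd]] := jz_rows 1%R.
have rjd v1 v2 v3 v4 : row4 v1 v2 v3 v4 *m val (unip 0 1 * d) =
    (row4 (v1 + v3 + v4) (v2 + v4) (v1 + v4) (v1 + v2 + v3 + v4))%R.
  rewrite row_mulg row4_unip rd /snorm twist0 !twist1; congr row4; ring2.
apply: GL_row4_inj => v1 v2 v3 v4.
move: (_ * d) rjd => r rjd.
rewrite row_mul1g !expgSr expg0 mul1g !row_mulg !rjd; congr row4; ring2.
Qed.

(** Halving the word of length ten keeps the polynomials in [jz_order5_inj] small. *)
Lemma braid5 (hT : finGroupType) (a b : hT) : a * a = 1 -> b * b = 1 ->
  (a * b) ^+ 5 = 1 -> a * b * a * b * a = b * a * b * a * b.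
Proof.
move=> aa bb; rewrite !expgSr expg0 mul1g => e.
have aK h : h * a * a = h by rewrite -mulgA aa mulg1.
have bK h : h * b * b = h by rewrite -mulgA bb mulg1.
by rewrite -[RHS]mul1g -e !mulgA !(aK, bK).
Qed.

(** As [j] fixes [row4 1 0 0 0], the braid relation shows that [d] fixes the image of this row under
    [j d j d j]. The last two coordinates then give [th c = 1]. *)
Lemma jz_order5_inj c : c != 0%R -> (j * unip 0 c ^ z) ^+ 5 = 1 -> c = 1%R.
Proof.
move=> c0; have tc0 : th c != 0%R by rewrite twist_eq0.
have [d [<- rd]] := jz_rows c; rewrite xhat_sqr => e.
have dd : d * d = 1.
  apply: GL_row4_inj => v1 v2 v3 v4; rewrite row_mulg !rd row_mul1g; congr row4; ring2.
have br := braid5 (unip0_sqr 1%R) dd e.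
have j1 : row4 1 0 0 0 *m val (unip 0 1) = row4 1 0 0 0 by rewrite row4_unip; congr row4; ring2.
have rj v1 v2 v3 v4 : row4 v1 v2 v3 v4 *m val (unip 0 1) =
    row4 (v1 + v3 + v4) (v2 + v4) v3 v4.
  by rewrite row4_unip /snorm twist0 twist1; congr row4; ring2.
pose v1 := (1 + c + th c + c * c + c * th c + th c * th c)%R.
have E1 : row4 1 0 0 0 *m val (unip 0 1 * d * unip 0 1 * d * unip 0 1) =
    row4 v1 (th c + th c * th c) (c * c + c * th c) (th c * th c).
  rewrite !row_mulg j1 rd rj rd rj; congr row4; rewrite ?/v1; ring2.
have : row4 1 0 0 0 *m val (unip 0 1 * d * unip 0 1 * d * unip 0 1) *m val d =
    row4 1 0 0 0 *m val (unip 0 1 * d * unip 0 1 * d * unip 0 1).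
  by rewrite [in RHS]br !row_mulg j1.
rewrite E1 rd => /row4_inj[_ _ e3 e4].
have v10 : v1 = 0%R.
  apply: (mulfI c0); rewrite mulr0; apply: (addrI (c * c + c * th c)%R).
  by rewrite e3 addr0.
move: e4; rewrite v10 mulr0 addr0 => e4.
have /eqP : (c * (th c * (th c + 1)) = 0)%R.
  apply: (addrI (th c * th c)%R); rewrite addr0 -[RHS]e4; ring2.
rewrite !mulf_eq0 (negPf c0) (negPf tc0) /= add_eq0_char2 => /eqP tc1.
by apply: twist_inj; rewrite twist1.
Qed.

(** The exponent undoes the torus factor of the Bruhat decomposition; what remains is [j * j] or a
    conjugate of [j * j ^ z]. *)
Lemma order5_exists g : g \in G -> exists i, (j * (j ^ (y ^+ i)) ^ g) ^+ 5 = 1.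
Proof.
have [N N0 yN] : exists2 N, (0 < N)%N & y ^+ N = 1.
  by exists #[y]; rewrite ?order_gt0 // expg_order.
have inv i : exists i', y ^+ i' * y ^+ i = 1.
  exists (i * N.-1)%N; rewrite -expgD -mulnSr prednK // mulnC expgM yN expg1n //.
case/geometric_Sz/bruhat=> [[i [a [b ->]]]|[i [a [b [c [d ->]]]]]];
    have [i' ii'] := inv i; exists i'.
  rewrite conjgM -[(_ ^ _) ^ (y ^+ i)]conjgM ii' conjg1 xhat_sqr unipJ.
  by rewrite twist0 mul0r mulr0 !addr0 unip0_sqr expg1n.
rewrite !conjgM -[(_ ^ _) ^ (y ^+ i)]conjgM ii' conjg1 {2}xhat_sqr unipJ.
rewrite twist0 mul0r mulr0 !addr0 -xhat_sqr.
have {1}-> : j = j ^ unip c d by rewrite xhat_sqr unipJ twist0 mul0r mulr0 !addr0.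
by rewrite -conjMg -conjXg jz_order5 conj1g.
Qed.

(** In both Bruhat cases the torus part takes [j] to [unip 0 b'], and the relation forces
    [b' = 1]. *)
Lemma order5_inv g : g \in G -> (j * j ^ g) ^+ 5 = 1 ->
  j ^ g = j \/ exists2 u, u \in G & j ^ u = j /\ j ^ g = (j ^ z) ^ u.
Proof.
case/geometric_Sz/bruhat=> [[i [a [b ->]]]|[i [a [b [c [d ->]]]]]].
  rewrite conjgM jJ_yX unipJ twist0 mul0r mulr0 !addr0 {1}xhat_sqr => e; left.
  set b' := ((k * k * w) ^+ i)%R in e *.
  have e1 : unip 0 1 * unip 0 b' = unip 0 (1 + b').
    by rewrite unipM twist0; congr unip; ring2.
  (* An element with trivial square equals its fifth power. *)
  move: e; rewrite e1 (expgSr _ 4) (expgM _ 2 2) !expgSr expg0 !mul1g unip0_sqr !mul1g -unip00.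
  case/unip_inj=> _ /eqP; rewrite add_eq0_char2 => /eqP <-.
  by rewrite xhat_sqr.
have jS p r : j ^ unip p r = j by rewrite xhat_sqr unipJ twist0 mul0r mulr0 !addr0.
rewrite !conjgM jJ_yX unipJ twist0 mul0r mulr0 !addr0.
set b' := ((k * k * w) ^+ i)%R => e; right.
exists (unip c d); first exact: Sz_unip.
have b'1 : b' = 1%R.
  apply: jz_order5_inj (kkw_exp_neq0 i) _; apply: (conjg_inj (unip c d)).
  by rewrite conj1g conjXg conjMg jS.
by rewrite b'1 -xhat_sqr jS.
Qed.

Lemma jz_conj_x : (j ^ z) ^ x = j ^ (j ^ z).
Proof.
rewrite xhat_sqr xhatE; have [d [<- rd]] := jz_rows 1%R.
have dd : d * d = 1.
  apply: GL_row4_inj => v1 v2 v3 v4; rewrite row_mulg !rd row_mul1g; congr row4; ring2.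
have dV : d^-1 = d by apply: (mulgI d); rewrite mulgV dd.
rewrite !conjgE dV; apply: (mulgI (unip 1 1)); rewrite mulKVg.
apply: GL_row4_inj => v1 v2 v3 v4; rewrite !row_mulg.
by rewrite !(row4_unip, rd) /snorm twist0 !twist1; congr row4; ring2.
Qed.

Lemma cent_j_jz u : u \in G -> j ^ u = j -> (j ^ z) ^ u = j ^ z -> u = 1.
Proof.
move=> uG /(cent_j uG)[a [b ->]]; rewrite xhat_sqr.
have [d [<- rd]] := jz_rows 1%R => du.
have : row4 1 0 0 0 *m val (unip a b * d) = row4 1 0 0 0 *m val (d * unip a b).
  by rewrite -{1}du conjgE mulKVg.
rewrite !row_mulg !(rd, row4_unip, twist0, twist1) => /row4_inj[_ e2 e3 _].
have a0 : a = 0%R.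
  apply: (addrI 1%R); move: e3; rewrite !(mul0r, mulr1, mul1r, add0r, addr0) => e3.
  by rewrite -e3.
move: e2; rewrite a0 twist0 !(mul0r, mulr0, mulr1, mul1r, add0r, addr0) => <-.
exact: unip00.
Qed.

Lemma j_central i : j ^ (x ^ (y ^+ i)) = j /\ j ^ (j ^ (y ^+ i)) = j.
Proof.
by rewrite xJ_yX jJ_yX xhat_sqr !unipJ twist0 !(mul0r, mulr0, addr0).
Qed.

End Facts.

Lemma suzuki_like_Sz : suzuki_like (Sz m omega) x y z #|F|.
Proof.
split.
- exact: Sz_x.
- exact: Sz_y.
- exact: Sz_z.
- exact: order_xhat.
- exact: order_yhat.
- exact: zhat_sqr.
- exact: j_central.
- exact: jz_conj_x.
- exact: cent_j_conj_x.
- exact: cent_x_factor.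
- exact: order5_exists.
- exact: order5_inv.
- exact: cent_j_jz.
Qed.

End SuzukiMatrices.

Lemma standard_generators_suzuki_like (F : finFieldType) (m : nat)
    (omega : {unit F}) (gT : finGroupType) (G : {group gT}) (x y z : gT) :
    0 < m -> #|F| = 2 ^ (2 * m + 1) -> generator [set: {unit F}] omega ->
  standard_generators m omega G x y z -> suzuki_like G x y z (suzq m).
Proof.
move=> m_gt0 cardF omega_gen [xG yG zG [f [isof fx fy fz]]].
apply: (suzuki_like_isom isof xG yG zG).
by rewrite fx fy fz /suzq -cardF; apply: suzuki_like_Sz.
Qed.

(** * Programs on group expressions *)

Inductive gexp : Type :=
  | GVar of nat
  | GMul of gexp & gexp
  | GInv of gexp.

Fixpoint gvars (e : gexp) : seq nat :=
  match e with
  | GVar i => [:: i]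
  | GMul a b => gvars a ++ gvars b
  | GInv a => gvars a
  end.

Fixpoint geval (gT : finGroupType) (v : nat -> gT) (e : gexp) : gT :=
  match e with
  | GVar i => v i
  | GMul a b => (geval v a * geval v b)%g
  | GInv a => (geval v a)^-1%g
  end.

Lemma eq_geval (gT : finGroupType) (v v' : nat -> gT) (e : gexp) :
  {in gvars e, v =1 v'} -> geval v e = geval v' e.
Proof.
elim: e => [i|a IHa b IHb|a IHa] /= vv'; first by rewrite vv' ?inE.
  by rewrite IHa ?IHb // => i ai; apply: vv'; rewrite mem_cat ai ?orbT.
by rewrite IHa.
Qed.

(* The value of [e] is left in e[d]; e[d+1], e[d+2], ... are scratch. A copy
   is made by inverting twice. *)
Fixpoint gcompile (e : gexp) (d : nat) : prog :=
  match e with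
  | GVar i => Seq (EInv d i) (EInv d d)
  | GMul a b => Seq (gcompile a d) (Seq (gcompile b d.+1) (EMul d d d.+1))
  | GInv a => Seq (gcompile a d) (EInv d d)
  end.

Fixpoint gcost (e : gexp) : nat :=
  match e with
  | GVar _ => 2
  | GMul a b => gcost a + (gcost b + 1)
  | GInv a => gcost a + 1
  end.

(* Registers e[r] with r < scratch hold the named values. *)
Definition scratch : nat := 15.

(** All evaluation takes place in scratch registers before [r] is overwritten, so [e] may mention
    [r]. The last inversion serves as the copy. *)
Definition assign (r : nat) (e : gexp) : prog :=
  Seq (gcompile (GInv e) scratch) (EInv r scratch).

(** * A program logic with two-sided time bounds *)

Section Logic.

Variables (gT : finGroupType) (U : {group gT}) (mu : nat) (B : blackbox U mu).

(** Strings are replaced by the elements they encode, since an element may have several codes. *)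
Record astate := AState {
  an : nat -> nat;
  ag : nat -> gT;
  atape : slp
}.

Definition ok (s : state B) : Prop := forall i, bb_valid (emem s i).

Definition val_at (s : state B) (i : nat) : gT := bb_elt (emem s i).

Definition represents (s : state B) (a : astate) : Prop :=
  [/\ ok s, nmem s = an a, tape s = atape a &
      forall i, i < scratch -> val_at s i = ag a i].

Lemma ok_sete s d w : ok s -> bb_valid w -> ok (sete s d w).
Proof. by move=> oks w_ok i; rewrite /= /upd; case: ifP. Qed.

Lemma val_sete (s : state B) d w i :
  val_at (sete s d w) i = upd (val_at s) d (bb_elt w) i.
Proof. by rewrite /val_at /= /upd; case: ifP. Qed.

Lemma exec_gcompile e d (s : state B) : ok s -> all (fun i => i < d) (gvars e) ->
  exists s', [/\ exec (gcompile e d) s (gcost e * mu) s', ok s',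
    nmem s' = nmem s, tape s' = tape s &
    val_at s' d = geval (val_at s) e /\
    forall i, i < d -> val_at s' i = val_at s i].
Proof.
elim: e d s => [i|a IHa b IHb|a IHa] d s oks /=.
- rewrite andbT => id; pose s1 := sete s d (bb_inv (emem s i)).
  have ok1 : ok s1 by apply: ok_sete => //; apply: bb_inv_valid.
  exists (sete s1 d (bb_inv (emem s1 d))); split=> //.
  + by rewrite mul2n -addnn; apply: XSeq; apply: XEInv.
  + by apply: ok_sete => //; apply: bb_inv_valid.
  split=> [|i' i'd]; rewrite val_sete /upd; last first.
    by rewrite ltn_eqF // val_sete /upd ltn_eqF.
  rewrite eqxx bb_invE // -/(val_at s1 d).
  by rewrite val_sete /upd eqxx bb_invE ?invgK.
- rewrite all_cat => /andP[ad bd].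
  have [s1 [x1 ok1 n1 t1 [v1 f1]]] := IHa d s oks ad.
  have bd' : all (fun i => i < d.+1) (gvars b).
    by apply: sub_all bd => i id; apply: ltnW.
  have [s2 [x2 ok2 n2 t2 [v2 f2]]] := IHb d.+1 s1 ok1 bd'.
  exists (sete s2 d (bb_mul (emem s2 d) (emem s2 d.+1))); split=> //.
  + rewrite !mulnDl mul1n; apply: XSeq x1 _; apply: XSeq x2 _; exact: XEMul.
  + by apply: ok_sete => //; apply: bb_mul_valid.
  + by rewrite /= n2.
  + by rewrite /= t2.
  split=> [|i id]; rewrite val_sete /upd; last by rewrite ltn_eqF // f2 ?f1 // ltnW.
  rewrite eqxx bb_mulE // -/(val_at s2 d) -/(val_at s2 d.+1) v2 f2 // v1.
  by congr (_ * _)%g; apply: eq_geval => i /(allP bd); apply: f1.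
- move=> ad; have [s1 [x1 ok1 n1 t1 [v1 f1]]] := IHa d s oks ad.
  exists (sete s1 d (bb_inv (emem s1 d))); split=> //.
  + by rewrite mulnDl mul1n; apply: XSeq x1 _; apply: XEInv.
  + by apply: ok_sete => //; apply: bb_inv_valid.
  split=> [|i id]; rewrite val_sete /upd; last by rewrite ltn_eqF ?f1.
  by rewrite eqxx bb_invE // -/(val_at s1 d) v1.
Qed.

(* [spec p a lo hi Q]: from every state represented by [a], the program [p]
   halts after between [lo * mu] and [hi * mu] bit operations in a state
   represented by some [a'] such that [Q a']. *)
Definition spec (p : prog) (a : astate) (lo hi : nat) (Q : astate -> Prop) :=
  forall s, represents s a -> exists t s' a',
    [/\ exec p s t s', represents s' a', Q a' & lo * mu <= t <= hi * mu].

Lemma spec_weaken p a lo hi lo' hi' (Q Q' : astate -> Prop) :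
    spec p a lo hi Q -> lo' <= lo -> hi <= hi' -> (forall a', Q a' -> Q' a') ->
  spec p a lo' hi' Q'.
Proof.
move=> sp llo hhi QQ s /sp[t [s' [a' [x r q /andP[lt th]]]]].
exists t, s', a'; split=> //; first exact: QQ.
by rewrite (leq_trans _ lt) ?(leq_trans th) ?leq_mul2r ?llo ?hhi ?orbT.
Qed.

Lemma spec_seq p1 p2 a lo1 hi1 lo2 hi2 (Q1 Q : astate -> Prop) :
    spec p1 a lo1 hi1 Q1 -> (forall a1, Q1 a1 -> spec p2 a1 lo2 hi2 Q) ->
  spec (Seq p1 p2) a (lo1 + lo2) (hi1 + hi2) Q.
Proof.
move=> sp1 sp2 s /sp1[t1 [s1 [a1 [x1 r1 q1 /andP[l1 h1]]]]].
have [t2 [s2 [a2 [x2 r2 q2 /andP[l2 h2]]]]] := sp2 _ q1 _ r1.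
exists (t1 + t2), s2, a2; split=> //; first exact: XSeq x1 x2.
by rewrite !mulnDl !leq_add.
Qed.

Lemma spec_assign r e n g tp : r < scratch ->
    all (fun i => i < scratch) (gvars e) ->
  spec (assign r e) (AState n g tp) 0 (gcost e + 2)
    (eq (AState n (upd g r (geval g e)) tp)).
Proof.
move=> rs es s [oks ns ts gs].
have [s1 [x1 ok1 n1 t1 [v1 f1]]] := @exec_gcompile (GInv e) scratch s oks es.
exists ((gcost e + 1) * mu + mu), (sete s1 r (bb_inv (emem s1 scratch))).
exists (AState n (upd g r (geval g e)) tp); split=> //.
- by apply: XSeq x1 _; apply: XEInv.
- split=> //=; rewrite ?n1 ?t1 //.
    by apply: ok_sete => //; apply: bb_inv_valid.
  move=> i il; rewrite val_sete /upd bb_invE //; case: eqP => // _.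
    rewrite -/(val_at s1 scratch) v1 /= invgK.
    by apply: eq_geval => i' /(allP es); apply: gs.
  by rewrite f1 // gs.
- by rewrite mul0n /= -{2}[mu]mul1n -mulnDl -addnA.
Qed.

Lemma spec_is1 d r n g tp : r < scratch ->
  spec (EIs1 d r) (AState n g tp) 1 1 (eq (AState (upd n d (g r == 1%g)) g tp)).
Proof.
move=> rs s [oks ns ts gs].
exists mu, (setn s d (bb_is1 (emem s r))), (AState (upd n d (g r == 1%g)) g tp).
split=> //; first exact: XEIs1.
  by split=> //=; rewrite ns bb_is1E // -/(val_at s r) gs.
by rewrite mul1n leqnn.
Qed.

Variable N : nat.
Hypotheses (mu_gt1 : 1 < mu) (N_small : bitlen N <= 3 * mu).

Lemma bitlen_le a b : a <= b -> bitlen a <= bitlen b.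
Proof. by move=> ab; rewrite /bitlen ltnS leq_trunc_log. Qed.

Lemma bitlen_small a : a <= N -> bitlen a <= 3 * mu.
Proof. by move=> aN; apply: leq_trans (bitlen_le aN) N_small. Qed.

Lemma bitlen_lt64 c : c < 64 -> bitlen c <= 6.
Proof. exact: (@bitlen_le c 63). Qed.

(** Such a constant has at most 6 bits, and [6 <= 3 * mu] as [1 < mu]. *)
Lemma spec_const d c n g tp : c < 64 ->
  spec (Const d c) (AState n g tp) 0 3 (eq (AState (upd n d c) g tp)).
Proof.
move=> c64 s [oks ns ts gs].
exists (bitlen c), (setn s d c), (AState (upd n d c) g tp).
split=> //; first exact: XConst; first by split=> //=; rewrite ns.
by rewrite mul0n /=; have := bitlen_lt64 c64; lia.
Qed.

Lemma spec_add d a b n g tp : n a <= N -> n b <= N ->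
  spec (Add d a b) (AState n g tp) 0 6 (eq (AState (upd n d (n a + n b)) g tp)).
Proof.
move=> aN bN s [oks ns ts gs].
exists (bitlen (nmem s a) + bitlen (nmem s b)), (setn s d (nmem s a + nmem s b)).
exists (AState (upd n d (n a + n b)) g tp).
split=> //; first exact: XAdd; first by split=> //=; rewrite ns.
by rewrite ns /=; have := bitlen_small aN; have := bitlen_small bN; lia.
Qed.

Lemma spec_sub d a b n g tp : n a <= N -> n b <= N ->
  spec (Sub d a b) (AState n g tp) 0 6 (eq (AState (upd n d (n a - n b)) g tp)).
Proof.
move=> aN bN s [oks ns ts gs].
exists (bitlen (nmem s a) + bitlen (nmem s b)), (setn s d (nmem s a - nmem s b)).
exists (AState (upd n d (n a - n b)) g tp).
split=> //; first exact: XSub; first by split=> //=; rewrite ns.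
by rewrite ns /=; have := bitlen_small aN; have := bitlen_small bN; lia.
Qed.

Lemma spec_skip a : spec Skip a 0 1 (eq a).
Proof.
move=> s rs; exists 1, s, a; split=> //; first exact: XSkip.
by rewrite mul0n mul1n /=; apply: ltnW.
Qed.

Lemma spec_if r p1 p2 n g tp lo hi Q : n r <= N ->
    (n r != 0 -> spec p1 (AState n g tp) lo hi Q) ->
    (n r = 0 -> spec p2 (AState n g tp) lo hi Q) ->
  spec (If r p1 p2) (AState n g tp) lo (3 + hi) Q.
Proof.
move=> rN sp1 sp2 s rs; have [oks ns ts gs] := rs; have := bitlen_small rN.
have [r0|r0] := eqVneq (n r) 0.
  have [t [s' [a' [x r' q /andP[l h]]]]] := sp2 r0 _ rs.
  exists (bitlen (nmem s r) + t), s', a'; split=> //.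
    by apply: XIfF => //; rewrite ns.
  by rewrite ns /= mulnDl; lia.
have [t [s' [a' [x r' q /andP[l h]]]]] := sp1 r0 _ rs.
exists (bitlen (nmem s r) + t), s', a'; split=> //.
  by apply: XIfT => //; rewrite ns.
by rewrite ns /= mulnDl; lia.
Qed.

(** The control register holds a Boolean, so a test costs one bit operation and there are exactly
    [T] rounds. The term [T * lo] is the source of the lower bound on the running time. *)
Lemma spec_while r p (Inv : nat -> astate -> Prop) lo hi T :
    (forall k a, k <= T -> Inv k a -> an a r = (k < T)) ->
    (forall k a, k < T -> Inv k a -> spec p a lo hi (Inv k.+1)) ->
  forall a, Inv 0 a -> spec (While r p) a (T * lo) (T * (hi + 3) + 3) (Inv T).
Proof.
move=> rI bI a I0; have bl1 (b : bool) : bitlen b <= 1 by case: b.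
suff H d k a' : k + d = T -> Inv k a' ->
    spec (While r p) a' (d * lo) (d * (hi + 3) + 3) (Inv T).
  exact: H (add0n T) I0.
elim: d k a' => [|d IH] k a' kT Ik s rs; have [oks ns ts gs] := rs.
  rewrite addn0 in kT; subst T.
  have r0 : nmem s r = 0 by rewrite ns (rI k) // ltnn.
  exists (bitlen (nmem s r)), s, a'; split=> //; first exact: XWhileF.
  by rewrite r0 !mul0n /= (leq_trans (bl1 false)) //; lia.
have kT' : k < T by lia.
have r1 : nmem s r = 1 by rewrite ns (rI k) ?kT' // ltnW.
have [t1 [s1 [a1 [x1 rs1 q1 /andP[l1 h1]]]]] := bI _ _ kT' Ik _ rs.
have [|t2 [s2 [a2 [x2 rs2 q2 /andP[l2 h2]]]]] := IH k.+1 _ _ q1 _ rs1.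
  by lia.
exists (bitlen (nmem s r) + t1 + t2), s2, a2; split=> //.
  by apply: XWhileT x1 x2; rewrite r1.
have b1 : bitlen 1 <= 1 := bl1 true.
move: l1 h1 l2 h2 b1; rewrite r1 !mulSn !mulnDl.
move: (d * lo * mu) (d * (hi + 3) * mu) (lo * mu) (hi * mu) (bitlen 1); lia.
Qed.

Lemma spec_emit_mul a b n g tp : bitlen (n a) <= 3 * mu -> bitlen (n b) <= 3 * mu ->
  spec (EmitMul a b) (AState n g tp) 0 6
    (eq (AState n g (rcons tp (CMul (n a) (n b))))).
Proof.
move=> aN bN s [oks ns ts gs].
exists (bitlen (nmem s a) + bitlen (nmem s b)).
exists (emit s (CMul (nmem s a) (nmem s b))).
exists (AState n g (rcons tp (CMul (n a) (n b)))).
split=> //; first exact: XEmitMul; first by split=> //=; rewrite ns ts.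
by rewrite ns /=; lia.
Qed.

Lemma spec_emit_inv a n g tp : bitlen (n a) <= 3 * mu ->
  spec (EmitInv a) (AState n g tp) 0 6
    (eq (AState n g (rcons tp (CInv (n a))))).
Proof.
move=> aN s [oks ns ts gs].
exists (bitlen (nmem s a)), (emit s (CInv (nmem s a))).
exists (AState n g (rcons tp (CInv (n a)))).
split=> //; first exact: XEmitInv; first by split=> //=; rewrite ns ts.
by rewrite ns /=; lia.
Qed.

Lemma spec_emit_pow a b n g tp : bitlen (n a) <= 3 * mu -> bitlen (n b) <= 3 * mu ->
  spec (EmitPow a b) (AState n g tp) 0 6
    (eq (AState n g (rcons tp (CPow (n a) (n b))))).
Proof.
move=> aN bN s [oks ns ts gs].
exists (bitlen (nmem s a) + bitlen (nmem s b)).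
exists (emit s (CPow (nmem s a) (nmem s b))).
exists (AState n g (rcons tp (CPow (n a) (n b)))).
split=> //; first exact: XEmitPow; first by split=> //=; rewrite ns ts.
by rewrite ns /=; lia.
Qed.

Lemma spec_seq_eq p1 p2 a a1 lo1 hi1 lo2 hi2 (Q : astate -> Prop) :
    spec p1 a lo1 hi1 (eq a1) -> spec p2 a1 lo2 hi2 Q ->
  spec (Seq p1 p2) a (lo1 + lo2) (hi1 + hi2) Q.
Proof. by move=> sp1 sp2; apply: spec_seq sp1 _ => _ <-. Qed.

Lemma spec_weaken_eq p a a' lo hi lo' hi' (Q : astate -> Prop) :
    spec p a lo hi (eq a') -> lo' <= lo -> hi <= hi' -> Q a' ->
  spec p a lo' hi' Q.
Proof. by move=> sp l h q; apply: spec_weaken sp l h _ => _ <-. Qed.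

End Logic.

(** * Search loops *)

(* e[0], ..., e[3] hold x, y, z, g; n[7] = 1 and n[8] = 0. In round i of the
   loop, e[4] = y ^+ i and e[5] = x ^+ i; when [test] evaluates to 1, the
   round number is stored in n[rn] and the value of [cand] in e[re]. *)
Definition search_body (test cand : gexp) (rn re : nat) : prog :=
  Seq (Add 4 4 7)
  (Seq (assign 4 (GMul (GVar 4) (GVar 1)))
  (Seq (assign 5 (GMul (GVar 5) (GVar 0)))
  (Seq (assign 6 test)
  (Seq (EIs1 6 6)
  (Seq (If 6 (Seq (Add rn 4 8) (assign re cand)) Skip)
  (Seq (assign 6 (GMul (GVar 4) (GVar 5)))
  (Seq (EIs1 6 6)
       (Sub 5 7 6)))))))).

Definition search (test cand : gexp) (rn re : nat) : prog :=
  Seq (assign 4 (GMul (GVar 1) (GInv (GVar 1))))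
  (Seq (assign 5 (GMul (GVar 1) (GInv (GVar 1))))
  (Seq (Const 4 0)
  (Seq (Const 5 1)
       (While 5 (search_body test cand rn re))))).

Definition round (gT : finGroupType) (v : nat -> gT) (x y : gT) (i : nat) :=
  upd (upd v 4 (y ^+ i)%g) 5 (x ^+ i)%g.

(** Register 6 is overwritten by the tests and [re] by hits, so the expressions must avoid both. *)
Definition search_vars (re : nat) (e : gexp) : bool :=
  all (fun i => [&& i < scratch, i != 6 & i != re]) (gvars e).

Section Search.

Variables (gT : finGroupType) (U : {group gT}) (mu : nat) (B : blackbox U mu).
Variable N : nat.
Hypotheses (mu_gt1 : 1 < mu) (N_small : bitlen N <= 3 * mu).
Variables x y : gT.
Hypothesis N_gt0 : 0 < N.
Hypotheses (xN : (x ^+ N = 1)%g) (yN : (y ^+ N = 1)%g).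
Hypothesis xyN : forall i, 0 < i < N -> (y ^+ i * x ^+ i != 1)%g.

Variables (test cand : gexp) (rn re : nat).
Hypotheses (rn_gt8 : 8 < rn) (re_gt6 : 6 < re) (re_lt : re < scratch).
Hypotheses (test_vars : search_vars re test) (cand_vars : search_vars re cand).

Variables (n : nat -> nat) (v : nat -> gT) (tp : slp).
Hypotheses (v0 : v 0 = x) (v1 : v 1 = y) (n7 : n 7 = 1) (n8 : n 8 = 0).

Let hit i := geval (round v x y i) test == 1%g.

Definition found (k : nat) (a : astate gT) : Prop :=
  [/\ an a rn = n rn, ag a re = v re & forall i, 0 < i <= k -> ~~ hit i] \/
  exists i, [/\ 0 < i <= k, hit i, an a rn = i &
                ag a re = geval (round v x y i) cand].

Definition search_frame (a : astate gT) : Prop :=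
  [/\ forall r, r \notin [:: 4; 5; 6; re] -> ag a r = v r,
      forall r, r \notin [:: 4; 5; 6; rn] -> an a r = n r &
      atape a = tp].

Definition in_round (k : nat) (a : astate gT) : Prop :=
  [/\ an a 4 = k, ag a 4 = (y ^+ k)%g & ag a 5 = (x ^+ k)%g].

Definition search_inv (k : nat) (a : astate gT) : Prop :=
  [/\ in_round k a, an a 5 = (k < N), search_frame a & found k a].

Lemma geval_round e k w : search_vars re e -> w 4 = (y ^+ k)%g ->
  w 5 = (x ^+ k)%g -> (forall r, r \notin [:: 4; 5; 6; re] -> w r = v r) ->
  geval w e = geval (round v x y k) e.
Proof.
move=> /allP ev w4 w5 wv; apply: eq_geval => i /ev/and3P[_ i6 ire].
rewrite /round /upd; case: eqP => [->//|/eqP i5]; case: eqP => [->//|/eqP i4].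
by apply: wv; rewrite !inE !negb_or i4 i5 i6.
Qed.

(** No loop bound is computed: the flag drops at the first positive [i] with [y ^+ i * x ^+ i = 1],
    which is [N]. *)
Lemma search_body_spec k a : k < N -> search_inv k a ->
  spec B (search_body test cand rn re) a 1 (gcost test + gcost cand + 60)
    (search_inv k.+1).
Proof.
case: a => n1 g1 tp1 kN [[/= n4 g4 g5] n5 [/= gf nf ->] res].
have g0 : g1 0 = x by rewrite gf ?v0 // !inE; lia.
have g1' : g1 1 = y by rewrite gf ?v1 // !inE; lia.
have m7 : n1 7 = 1 by rewrite nf ?n7 // !inE; lia.
have m8 : n1 8 = 0 by rewrite nf ?n8 // !inE; lia.
have sv e : search_vars re e -> all (fun i => i < scratch) (gvars e).
  by apply: sub_all => i /and3P[].
pose n2 := upd n1 4 k.+1.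
pose g2 := upd (upd g1 4 (y ^+ k.+1)%g) 5 (x ^+ k.+1)%g.
have g2E e : search_vars re e -> geval g2 e = geval (round v x y k.+1) e.
  move=> ev; apply: geval_round => // r; rewrite !inE !negb_or => /and4P[r4 r5 r6 rre].
  by rewrite /g2 /upd (negPf r4) (negPf r5) gf // !inE !negb_or r4 r5 r6.
pose g3 := upd g2 6 (geval g2 test).
have g3E e : search_vars re e -> geval g3 e = geval (round v x y k.+1) e.
  move=> ev; rewrite -g2E //; apply: eq_geval => i /(allP ev)/and3P[_ i6 _].
  by rewrite /g3 /upd (negPf i6).
pose n3 := upd n2 6 (hit k.+1).
pose mid a := [/\ in_round k.+1 a, search_frame a & found k.+1 a].
have s4 : spec B (If 6 (Seq (Add rn 4 8) (assign re cand)) Skip) (AState n3 g3 tp)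
    0 (3 + (6 + (gcost cand + 2))) mid.
  apply: (spec_if mu_gt1 N_small) => [|h|h].
  - by rewrite /n3 /upd /=; case: hit.
  - have {}h : hit k.+1 by move: h; rewrite /n3 /upd /=; case: hit.
    apply: (@spec_seq_eq _ _ _ _ _ _ _ _ 0 6 0).
      by apply: (spec_add mu_gt1 N_small); rewrite /n3 /n2 /upd /= ?m8.
    apply: (spec_weaken_eq (spec_assign re_lt (sv _ cand_vars))) => //.
    rewrite g3E // /n3 /n2 /upd /= m8 addn0.
    split; first split; rewrite /= /upd //=.
    + by rewrite ltn_eqF //; lia.
    + by rewrite ltn_eqF //; lia.
    + by rewrite ltn_eqF //; lia.
    + split=> //= r; rewrite !inE !negb_or => /and4P[r4 r5 r6 rr].
        rewrite (negPf rr) /g3 /g2 /upd (negPf r6) (negPf r5) (negPf r4).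
        by apply: gf; rewrite !inE !negb_or r4 r5 r6 rr.
      rewrite (negPf rr) (negPf r6) (negPf r4).
      by apply: nf; rewrite !inE !negb_or r4 r5 r6 rr.
    by right; exists k.+1; rewrite /= /upd !eqxx ltnSn.
  have {}h : ~~ hit k.+1 by move: h; rewrite /n3 /upd /=; case: hit.
  apply: (spec_weaken_eq (@spec_skip _ _ _ _ mu_gt1 _)) => //.
  split.
  - by split.
  - split=> //= r; rewrite !inE !negb_or => /and4P[r4 r5 r6 rr].
      rewrite /g3 /g2 /upd (negPf r6) (negPf r5) (negPf r4).
      by apply: gf; rewrite !inE !negb_or r4 r5 r6 rr.
    rewrite /n3 /n2 /upd (negPf r6) (negPf r4).
    by apply: nf; rewrite !inE !negb_or r4 r5 r6 rr.
  have rn46 : (rn == 4) = false /\ (rn == 6) = false by split; lia.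
  have re456 : [/\ (re == 4) = false, (re == 5) = false & (re == 6) = false].
    by split; lia.
  case: rn46 re456 => rn4 rn6 [re4 re5 re6].
  case: res => [[/= rN rV rH]|[i [/= ik hi rN rV]]]; [left | right].
    rewrite /= /n3 /n2 /g3 /g2 /upd rn4 rn6 re4 re5 re6; split=> // i.
    case/andP=> i0; rewrite leq_eqVlt => /orP[/eqP->//|ik].
    by apply: rH; rewrite i0.
  exists i; rewrite /= /n3 /n2 /g3 /g2 /upd rn4 rn6 re4 re5 re6; split=> //.
  by case/andP: ik => -> /leqW.
have s5 a : mid a -> spec B (Seq (assign 6 (GMul (GVar 4) (GVar 5)))
    (Seq (EIs1 6 6) (Sub 5 7 6))) a 1 (7 + (1 + 6)) (search_inv k.+1).
  case: a => n4' g4' tp4 [[/= a4 b4 b5] [/= gf' nf' ->] fd].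
  have c7 : n4' 7 = 1 by rewrite nf' ?n7 // !inE; lia.
  apply: (@spec_seq_eq _ _ _ _ _ _ _ _ 0 7 1 7); first exact: spec_assign.
  apply: (@spec_seq_eq _ _ _ _ _ _ _ _ 1 1 0 6); first exact: spec_is1.
  apply: (spec_weaken_eq (spec_sub mu_gt1 N_small _ _ _)) => //.
  - by rewrite /upd /= c7.
  - by rewrite /upd /=; case: (_ == _); rewrite ?N_gt0.
  rewrite /upd /= c7 b4 b5.
  split.
  - by split.
  - rewrite /=; case: (ltngtP k.+1 N) => [lt|gt|eq].
    + by rewrite (negPf (xyN _)).
    + by rewrite ltnNge kN in gt.
    + by rewrite eq xN yN mulg1 eqxx.
  - split=> //= r; rewrite !inE !negb_or => /and4P[r4 r5 r6 rr].
      by rewrite (negPf r6); apply: gf'; rewrite !inE !negb_or r4 r5 r6 rr.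
    rewrite (negPf r6) (negPf r5).
    by apply: nf'; rewrite !inE !negb_or r4 r5 r6 rr.
  have [rn5 rn6 re6] : [/\ (rn == 5) = false, (rn == 6) = false & (re == 6) = false].
    by split; lia.
  by rewrite /found /= rn5 rn6 re6.
(* The ones in the lower sum are identity tests, each of cost exactly [mu]. *)
apply: (@spec_weaken _ _ _ _ _ _ (0 + (0 + (0 + (0 + (1 + (0 + 1))))))
  (6 + (7 + (7 + (gcost test + 2 +
    (1 + (3 + (6 + (gcost cand + 2)) + (7 + (1 + 6))))))))
  _ _ (search_inv k.+1)) => //; last by lia.
apply: (@spec_seq_eq _ _ _ _ _ _ _ _ 0 6); first by
  apply: (spec_add mu_gt1 N_small); rewrite ?n4 ?m7 //; lia.
rewrite n4 m7 addn1 -/n2.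
apply: (@spec_seq_eq _ _ _ _ _ _ _ _ 0 7); first exact: spec_assign.
apply: (@spec_seq_eq _ _ _ _ _ _ _ _ 0 7); first exact: spec_assign.
rewrite [geval _ _]/= [geval _ _]/= {1 2 3 4}/upd /= g4 g5 g0 g1' -!expgSr -/g2.
apply: (@spec_seq_eq _ _ _ _ _ _ _ _ 0 (gcost test + 2)).
  by apply: spec_assign => //; apply: sv.
apply: (@spec_seq_eq _ _ _ _ _ _ _ _ 1 1); first exact: spec_is1.
rewrite -/g3.
have -> : (g3 6 == 1%g) = hit k.+1 by rewrite /g3 /upd /= g2E.
by apply: spec_seq s4 _ => a /s5.
Qed.

Lemma search_spec :
  spec B (search test cand rn re) (AState n v tp) N
    (N * (gcost test + gcost cand + 63) + 30)
    (fun a => search_frame a /\ found N a).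
Proof.
pose n' := upd (upd n 4 0) 5 1; pose v' := upd (upd v 4 1%g) 5 1%g.
apply: (@spec_weaken _ _ _ _ _ _ (0 + (0 + (0 + (0 + N * 1))))
  (8 + (8 + (3 + (3 + (N * (gcost test + gcost cand + 60 + 3) + 3))))) _ _ (search_inv N)) => //; first last.
- by move=> a' [].
- by lia.
- by lia.
apply: (@spec_seq_eq _ _ _ _ _ _ _ _ 0 8); first exact: spec_assign.
apply: (@spec_seq_eq _ _ _ _ _ _ _ _ 0 8); first exact: spec_assign.
apply: (@spec_seq_eq _ _ _ _ _ _ _ _ 0 3); first exact: (spec_const mu_gt1 N_small).
apply: (@spec_seq_eq _ _ _ _ _ _ _ _ 0 3); first exact: (spec_const mu_gt1 N_small).
apply: (spec_while mu_gt1 N_small) => [k a _ [_ ->]//|k a kN|].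
  exact: search_body_spec.
rewrite /= /upd /= mulgV; split.
- by split.
- by rewrite /= N_gt0.
- by split=> //= r; rewrite !inE !negb_or => /and4P[/negPf-> /negPf->].
have [rn4 rn5 re4 re5] : [/\ (rn == 4) = false, (rn == 5) = false,
  (re == 4) = false & (re == 5) = false] by split; lia.
left; rewrite /= rn4 rn5 re4 re5; split=> // i.
by case: i.
Qed.

End Search.

(** * Output of straight line programs *)

(** Registers 15 and 16 are free for cell numbers, because templates take exponents from registers 9
    to 14. *)
Definition emit_cell (c : slp_cell) : prog :=
  match c with
  | CMul i j => Seq (Const 15 i) (Seq (Const 16 j) (EmitMul 15 16))
  | CInv i => Seq (Const 15 i) (EmitInv 15)
  | CPow i r => Seq (Const 15 i) (EmitPow 15 r)
  end.

Definition emit_slp (l : slp) : prog :=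
  foldr (fun c => Seq (emit_cell c)) Skip l.

(* In a template, [CPow i r] stands for the power with exponent n[r]. *)
Definition instantiate (n : nat -> nat) (c : slp_cell) : slp_cell :=
  if c is CPow i r then CPow i (n r) else c.

Definition template_cell (c : slp_cell) : bool :=
  match c with
  | CMul i j => (i < 64) && (j < 64)
  | CInv i => i < 64
  | CPow i r => (i < 64) && (8 < r < 15)
  end.

Lemma slp_length_instantiate (n : nat -> nat) (l : slp) (N : nat) :
    all template_cell l -> (forall r, 8 < r < 15 -> n r <= N) ->
  slp_length (map (instantiate n) l) <= size l * maxn 1 (up_log 2 N).
Proof.
move=> + nN; elim: l => //= c l IH /andP[c_ok l_ok].
rewrite /slp_length /= mulSn leq_add ?IH //.
case: c c_ok => [i j _|i _|i r /andP[_ rl]] /=; rewrite ?leq_maxl //.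
by rewrite geq_max leq_maxl leq_max leq_up_log ?nN ?orbT.
Qed.

Section Emit.

Variables (gT : finGroupType) (U : {group gT}) (mu : nat) (B : blackbox U mu).
Variable N : nat.
Hypotheses (mu_gt1 : 1 < mu) (N_small : bitlen N <= 3 * mu).

Lemma emit_cell_spec c n g tp : template_cell c ->
    (forall r, 8 < r < 15 -> bitlen (n r) <= 3 * mu) ->
  spec B (emit_cell c) (AState n g tp) 0 12
    (fun a => atape a = rcons tp (instantiate n c) /\
              forall r, r < 15 -> an a r = n r).
Proof.
have small i : i < 64 -> bitlen i <= 3 * mu by move/bitlen_lt64; lia.
case: c => [i j|i|i r] /=.
- move=> /andP[i64 j64] nN.
  apply: (@spec_seq_eq _ _ _ _ _ _ _ _ 0 3 0 9).
    exact: (spec_const mu_gt1 N_small).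
  apply: (@spec_seq_eq _ _ _ _ _ _ _ _ 0 3 0 6).
    exact: (spec_const mu_gt1 N_small).
  apply: (spec_weaken_eq (spec_emit_mul mu_gt1 N_small _ _)) => //; rewrite ?small //.
  by split=> // r r15; rewrite /= /upd !ltn_eqF // ltnW.
- move=> i64 nN.
  apply: (@spec_seq_eq _ _ _ _ _ _ _ _ 0 3 0 9).
    exact: (spec_const mu_gt1 N_small).
  apply: (spec_weaken_eq (spec_emit_inv mu_gt1 N_small _)) => //; rewrite ?small //.
  by split=> // r r15; rewrite /= /upd !ltn_eqF.
- move=> /andP[i64 rl] nN; have /andP[_ r15] := rl.
  apply: (@spec_seq_eq _ _ _ _ _ _ _ _ 0 3 0 9).
    exact: (spec_const mu_gt1 N_small).
  apply: (spec_weaken_eq (spec_emit_pow mu_gt1 N_small _ _)) => //.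
    exact: small.
    by rewrite /upd ltn_eqF // nN.
  by split=> [|s s15]; rewrite /= /upd ?(ltn_eqF r15) // ltn_eqF.
Qed.

Lemma emit_slp_spec l n g tp : all template_cell l ->
    (forall r, 8 < r < 15 -> bitlen (n r) <= 3 * mu) ->
  spec B (emit_slp l) (AState n g tp) 0 (size l * 12 + 1)
    (fun a => atape a = tp ++ map (instantiate n) l /\
              forall r, r < 15 -> an a r = n r).
Proof.
elim: l n g tp => [|c l IH] n g tp /= => [_ _|/andP[c_ok l_ok] nN].
  by apply: (spec_weaken_eq (@spec_skip _ _ _ _ mu_gt1 _)) => //; rewrite cats0.
rewrite mulSn -addnA.
apply: (@spec_seq _ _ _ _ _ _ _ 0 12 0 (size l * 12 + 1) _ _
  (@emit_cell_spec c n g tp c_ok nN)).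
case=> n1 g1 tp1 /= [-> n1E].
have eqi : map (instantiate n1) l = map (instantiate n) l.
  elim: (l) l_ok => //= c' l' IHl /andP[c'_ok /IHl->]; congr (_ :: _).
  by case: c' c'_ok => //= i r /andP[_ /andP[_ r15]]; rewrite n1E.
apply: spec_weaken (@IH n1 g1 _ l_ok _) _ _ _ => // [r r15|a [-> aE]].
  by rewrite n1E ?nN //; case/andP: r15.
by rewrite eqi cat_rcons; split=> // r r15; rewrite aE ?n1E.
Qed.

End Emit.

(** * Program stages on named registers *)

Section Stages.

Variables (gT : finGroupType) (U : {group gT}) (mu : nat) (B : blackbox U mu).
Variable N : nat.
Hypotheses (mu_gt1 : 1 < mu) (N_small : bitlen N <= 3 * mu).
Variables x y : gT.
Hypothesis N_gt0 : 0 < N.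
Hypotheses (xN : (x ^+ N = 1)%g) (yN : (y ^+ N = 1)%g).
Hypothesis xyN : forall i, 0 < i < N -> (y ^+ i * x ^+ i != 1)%g.

Definition named (r : nat) : bool := (r < 15) && (r \notin [:: 4; 5; 6]).

(** With lists of register contents the whole program is executed symbolically by computing
    [set_nth]. Group registers 4, 5 and 6, which every search overwrites, are left out. *)
Definition holds (nl : seq nat) (vl : seq gT) (a : astate gT) : Prop :=
  [/\ forall r, 6 < r < 15 -> an a r = nth 0 nl r,
      forall r, named r -> ag a r = nth 1%g vl r & atape a = [::]].

Lemma assign_stage r e nl vl a : 6 < r < 15 -> all named (gvars e) ->
    holds nl vl a ->
  spec B (assign r e) a 0 (gcost e + 2)
    (holds nl (set_nth 1%g vl r (geval (nth 1%g vl) e))).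
Proof.
case: a => n g tp r15 ev [/= nE gE tE].
have ev' : all (fun i => i < scratch) (gvars e).
  by apply: sub_all ev => i /andP[].
apply: (spec_weaken_eq (spec_assign _ ev')) => //; first by case/andP: r15.
split=> //= i il; rewrite nth_set_nth /= /upd; case: eqP => // _; last exact: gE.
by apply: eq_geval => i' /(allP ev); apply: gE.
Qed.

Lemma const_stage r c nl vl a : 6 < r < 15 -> c < 64 -> holds nl vl a ->
  spec B (Const r c) a 0 3 (holds (set_nth 0 nl r c) vl).
Proof.
case: a => n g tp r15 c64 [/= nE gE tE].
apply: (spec_weaken_eq (spec_const mu_gt1 N_small _ c64)) => //.
by split=> //= i il; rewrite nth_set_nth /= /upd; case: eqP => // _; apply: nE.
Qed.

(** The conditions on [rn] and [re] install round 0 as a default, so index and value agree even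
    after a failed search. *)
Lemma search_stage test cand rn re nl vl a :
    8 < rn < 15 -> 6 < re < 15 -> search_vars re test -> search_vars re cand ->
    nth 1%g vl 0 = x -> nth 1%g vl 1 = y -> nth 0 nl 7 = 1 -> nth 0 nl 8 = 0 ->
    nth 0 nl rn = 0 ->
    nth 1%g vl re = geval (round (nth 1%g vl) x y 0) cand ->
    holds nl vl a ->
  spec B (search test cand rn re) a N (N * (gcost test + gcost cand + 63) + 30)
    (fun a' => exists i, [/\ i <= N,
       (exists k, geval (round (nth 1%g vl) x y k) test = 1%g) ->
         geval (round (nth 1%g vl) x y i) test = 1%g &
       holds (set_nth 0 nl rn i)
         (set_nth 1%g vl re (geval (round (nth 1%g vl) x y i) cand)) a']).
Proof.
case: a => n v tp /andP[rn8 rn15] /andP[re6 re15] tv cv x0 y1 n7 n8 rn0 re0 [/= nE gE tE].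
have roundE i e : search_vars re e ->
    geval (round v x y i) e = geval (round (nth 1%g vl) x y i) e.
  move=> ev; apply: eq_geval => r /(allP ev)/and3P[r15 r6 _].
  rewrite /round /upd; case: eqP => // /eqP r5; case: eqP => // /eqP r4.
  by apply: gE; rewrite /named !inE !negb_or r4 r5 r6 r15.
have v0 : v 0 = x by rewrite gE.
have v1 : v 1 = y by rewrite gE.
have m7 : n 7 = 1 by rewrite nE.
have m8 : n 8 = 0 by rewrite nE.
have sp := @search_spec _ _ _ B _ mu_gt1 N_small _ _ N_gt0 xN yN xyN _ _ _ _
  rn8 re6 re15 tv cv n v tp v0 v1 m7 m8.
apply: (spec_weaken sp) => // -[n' v' tp'] [[/= gf nf ->] res].
have [i [iN hi nE' gE']] : exists i, [/\ i <= N,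
    (exists k, geval (round (nth 1%g vl) x y k) test = 1%g) ->
         geval (round (nth 1%g vl) x y i) test = 1%g,
    n' rn = i & v' re = geval (round (nth 1%g vl) x y i) cand].
  case: res => [[/= e1 e2 nohit]|[i [/= /andP[_ iN] /eqP hi -> ->]]].
    exists 0; split=> //; first last.
    - by rewrite e2 gE ?re0 // /named re15 !inE; lia.
    - by rewrite e1 nE ?rn0 //; lia.
    (* Rounds run from 1 to [N], so residue 0 is represented by [N]. *)
    case=> k hk; pose k' := if k %% N == 0 then N else k %% N.
    have kE (w : gT) : (w ^+ N = 1)%g -> (w ^+ k' = w ^+ k)%g.
      move=> wN; rewrite /k' -(expg_mod k wN); case: eqP => // ->.
      by rewrite wN expg0.
    have /negP[] : ~~ (geval (round v x y k') test == 1%g).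
      apply: nohit; rewrite /k'; have := ltn_pmod k N_gt0.
      by case: eqP => [_ _|/eqP]; rewrite ?N_gt0 ?leqnn // -lt0n => -> /ltnW.
    by rewrite roundE // -{2}hk /round !kE.
  by exists i; rewrite iN -!roundE.
exists i; split=> //; split=> //= r rl; rewrite nth_set_nth /=.
  case: eqP => [->//|/eqP rr]; rewrite nf ?nE //.
  by rewrite !inE !negb_or rr; lia.
case: eqP => [->//|/eqP rr]; rewrite gf ?gE //.
by move: rl; rewrite /named !inE !negb_or rr => /andP[_ /and3P[-> -> ->]].
Qed.

End Stages.

(** * The membership algorithm *)

Section Decomposition.
Local Open Scope group_scope.

Variables (gT : finGroupType) (G : {group gT}) (x y z : gT) (q : nat).
Hypothesis L : suzuki_like G x y z q.

Let j := x ^+ 2.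

Lemma sl_t i : x ^ (y ^+ i) \in G.
Proof. by rewrite groupJ ?groupX ?(sl_x L) ?(sl_y L). Qed.

Lemma sl_v i : x ^+ i * j ^ (y ^+ i) \in G.
Proof. by rewrite groupM ?groupJ ?groupX ?(sl_x L) ?(sl_y L). Qed.

Lemma sl_j_t i : j ^ (x ^ (y ^+ i)) = j.
Proof. by case: (sl_j_cent L i). Qed.

Lemma sl_j_v i : j ^ (x ^+ i * j ^ (y ^+ i)) = j.
Proof.
have jx : j ^ (x ^+ i) = j.
  by apply/conjg_fixP/commgP; apply: commuteX2.
by rewrite conjgM jx; case: (sl_j_cent L i).
Qed.

(** This is [sl_jz_x] conjugated by [u]. *)
Lemma conj_x_eq u c : j ^ u = j -> c = (j ^ z) ^ u -> c ^ (x ^ u) = j ^ c.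
Proof.
by move=> ju cE; rewrite cE -conjJg -{2}ju -(conjJg j) -(sl_jz_x L).
Qed.

(** Both [x ^ t] and [x ^ u] fix [j] and send [c] to the same element, so their quotient centralises
    [j] and [c]. Conjugated back by [u] it centralises [j] and [j ^ z], hence is trivial by
    [sl_free]. *)
Lemma conj_x_unique u t c : u \in G -> t \in G -> j ^ u = j -> j ^ t = j ->
  c = (j ^ z) ^ u -> c ^ (x ^ t) = j ^ c -> x ^ t = x ^ u.
Proof.
move=> uG tG ju jt cE ct; have xG := sl_x L.
have jx : j ^ x = j by apply/conjg_fixP/commgP/commute_sym/commuteX/commute_refl.
have cu := conj_x_eq ju cE.
have fix_jx w : j ^ w = j -> j ^ (x ^ w) = j.
  by move=> jw; rewrite -{1}jw -conjJg jx.
have := fix_jx _ jt; have := fix_jx _ ju; move: ct; rewrite -cu.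
have : x ^ t \in G by rewrite groupJ.
have : x ^ u \in G by rewrite groupJ.
move: (x ^ t) (x ^ u) => p r rG pG cpr jr jp.
have : u * (p * r^-1) * u^-1 = 1.
  apply: (sl_free L); rewrite -/j.
  - by rewrite !(groupM, groupV).
  - have inv w : j ^ w = j -> j ^ w^-1 = j by move=> jw; rewrite -{1}jw conjgK.
    by rewrite !conjgM ju jp !inv.
  - apply: (conjg_inj u); rewrite -conjgM mulgKV -cE.
    by rewrite !conjgM -cE cpr conjgK.
move/(canRL (mulgKV _)); rewrite mul1g => /(canRL (mulKg _)); rewrite mulVg.
by move/(canRL (mulgKV _)); rewrite mul1g.
Qed.

Lemma factor_cent_x u t : u \in G -> t \in G -> x ^ t = x ^ u ->
  exists i, u = x ^+ i * j ^ (y ^+ i) * t.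
Proof.
move=> uG tG xtu; have [||i e] := sl_cent_x L (u := u * t^-1).
- by rewrite groupM ?groupV.
- by rewrite conjgM -xtu conjgK.
by exists i; rewrite -e mulgKV.
Qed.

Lemma order5_cases h g : h \in G -> g \in G ->
    (j * (j ^ h) ^ g) ^+ 5 = 1 ->
  (j ^ h) ^ g = j \/
  exists2 u, u \in G & j ^ u = j /\ (j ^ h) ^ g = (j ^ z) ^ u.
Proof.
by move=> hG gG; rewrite -conjgM => /(sl_order5_inv L)-/(_ (groupM hG gG)).
Qed.

End Decomposition.

(** * The program *)

(** The bracketing here and in [gpow5] makes evaluated expressions convertible to the notation for
    conjugates and powers. *)
Definition gconj (a b : gexp) : gexp := GMul (GInv b) (GMul a b).
Definition gpow5 (a : gexp) : gexp := GMul a (GMul a (GMul a (GMul a a))).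

Definition gx := GVar 0.
Definition gy := GVar 1.
Definition gz := GVar 2.
Definition gg := GVar 3.
Definition gj : gexp := GMul gx gx.
(* In round i: x ^ (y ^+ i) and x ^+ i * (x ^+ 2) ^ (y ^+ i). *)
Definition gt_round : gexp := gconj gx (GVar 4).
Definition gv_round : gexp := GMul (GVar 5) (gconj gj (GVar 4)).

(* Register use: e[7] = c, e[8] = h = y ^+ n[9], e[9] = t, e[10] = v,
   e[11] = z ^+ n[12], e[12] = g', e[13] = t', e[14] = v'; the indices of t, v,
   t', v' are in n[10], n[11], n[13], n[14]. The values and indices match even
   if a search fails, so that the last test is sound for every g. *)
Definition init_prog : prog :=
  Seq (Const 7 1) (Seq (Const 8 0) (Seq (Const 9 0) (Seq (Const 10 0)
  (Seq (Const 11 0) (Seq (Const 13 0) (Seq (Const 14 0)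
  (Seq (assign 8 (GMul gy (GInv gy))) (Seq (assign 9 gx) (Seq (assign 10 gj)
  (Seq (assign 13 gx) (assign 14 gj))))))))))).

Definition delta_prog : prog :=
  Seq (assign 6 (GMul (GInv gj) (GVar 7)))
  (Seq (EIs1 6 6)
  (If 6 (Seq (Const 12 0) (assign 11 (GMul gz (GInv gz))))
        (Seq (Const 12 1) (assign 11 gz)))).

(* Values: 9 is v', 13 is t', 14 is z or 1, 21 is v, 25 is t, 27 is h^-1. *)
Definition answer_template : slp :=
  [:: CPow 1 14; CInv 3; CPow 0 14; CMul 5 4; CMul 6 0; CMul 7 0; CMul 8 3;
      CPow 1 13; CInv 10; CMul 11 0; CMul 12 10;
      CPow 2 12;
      CPow 1 11; CInv 15; CPow 0 11; CMul 17 16; CMul 18 0; CMul 19 0; CMul 20 15;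
      CPow 1 10; CInv 22; CMul 23 0; CMul 24 22;
      CPow 1 9; CInv 26;
      CMul 27 9; CMul 28 13; CMul 29 14; CMul 30 21; CMul 31 25].

Definition membership : prog :=
  Seq init_prog
  (Seq (search (gpow5 (GMul gj (gconj (gconj gj (GVar 4)) gg))) (GVar 4) 9 8)
  (Seq (assign 7 (gconj (gconj gj (GVar 8)) gg))
  (Seq (search (GMul (GInv (gconj (GVar 7) (gconj gx gt_round)))
                     (gconj gj (GVar 7))) gt_round 10 9)
  (Seq (search (GMul (GInv (GVar 7))
                     (gconj (gconj gj gz) (GMul gv_round (GVar 9))))
               gv_round 11 10)
  (Seq delta_prog
  (Seq (assign 12 (GMul (GMul (GMul (GVar 8) gg)
                              (GInv (GMul (GVar 10) (GVar 9)))) (GVar 11)))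
  (Seq (search (GMul (GInv (gconj gx gt_round)) (gconj gx (GVar 12)))
               gt_round 13 13)
  (Seq (search (GMul (GInv (GVar 12)) (GMul gv_round (GVar 13)))
               gv_round 14 14)
  (Seq (assign 6 (GMul (GInv (GVar 12)) (GMul (GVar 14) (GVar 13))))
  (Seq (EIs1 0 6)
       (emit_slp answer_template))))))))))).

(** * Correctness and cost of the program *)

Section Membership.

Variables (gT : finGroupType) (U : {group gT}) (mu : nat) (B : blackbox U mu).
Variables (G : {group gT}) (x y z g : gT) (q : nat).
Hypothesis L : suzuki_like G x y z q.
Hypothesis q_gt1 : 1 < q.
Hypothesis q_even : ~~ odd q.
Let N := 4 * q.-1.
Hypotheses (mu_gt1 : 1 < mu) (N_small : bitlen N <= 3 * mu).

(** The rest of the time budget is passed on by truncated subtraction, so costs need not be summed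
    in advance. *)
Lemma spec_step p1 p2 (a : astate gT) lo1 hi1 lo hi (Q1 Q : astate gT -> Prop) :
    spec B p1 a lo1 hi1 Q1 -> hi1 <= hi ->
    (forall a1, Q1 a1 -> spec B p2 a1 (lo - lo1) (hi - hi1) Q) ->
  spec B (Seq p1 p2) a lo hi Q.
Proof.
move=> sp1 h sp2; apply: spec_weaken (spec_seq sp1 sp2) _ _ _ => //; lia.
Qed.

Lemma x_exp_N : (x ^+ N = 1)%g.
Proof. by rewrite /N expgM -(sl_order_x L) expg_order expg1n. Qed.

Lemma y_exp_N : (y ^+ N = 1)%g.
Proof. by rewrite /N mulnC expgM -(sl_order_y L) expg_order expg1n. Qed.

(** Cyclic groups of coprime orders 4 and [q.-1] meet trivially, so a trivial product has trivial
    factors, and [i] would be a multiple of [N]. *)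
Lemma xy_exp i : 0 < i < N -> (y ^+ i * x ^+ i != 1)%g.
Proof.
case/andP=> i0 iN; apply/eqP => yx.
have co : coprime #[x]%g #[y]%g.
  rewrite (sl_order_x L) (sl_order_y L) (@coprime_pexpl 2 2) // coprime2n.
  by move: q_gt1 q_even; case: (q) => //= q' _; rewrite negbK.
have e : (y ^+ i = x ^- i)%g by apply: (mulIg (x ^+ i)%g); rewrite yx mulVg.
have yi : (y ^+ i = 1)%g.
  apply/set1P; have: (y ^+ i)%g \in <[x]>%g :&: <[y]>%g.
    by rewrite inE mem_cycle andbT e groupV mem_cycle.
  by rewrite (coprime_TIg co).
have xi : (x ^+ i = 1)%g by rewrite -[LHS]mul1g -{1}yi.
have: N %| i.
  rewrite /N -(sl_order_x L) -(sl_order_y L) Gauss_dvd // !order_dvdn.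
  by rewrite xi yi eqxx.
by move/(dvdn_leq i0); rewrite leqNgt iN.
Qed.

Lemma N_pos : 0 < N.
Proof. by rewrite /N; lia. Qed.

Lemma init_spec a : ag a 0 = x -> ag a 1 = y -> ag a 2 = z -> ag a 3 = g ->
    atape a = [::] ->
  spec B init_prog a 0 100 (fun a' => exists n0 n1 n2 n3 n4 n5 n6 n12 v4 v5 v6 v7 v11 v12,
    holds [:: n0; n1; n2; n3; n4; n5; n6; 1; 0; 0; 0; 0; n12; 0; 0]
      [:: x; y; z; g; v4; v5; v6; v7; 1%g; x; x ^+ 2; v11; v12; x; x ^+ 2]%g a').
Proof.
move=> e0 e1 e2 e3 et.
have h0 : holds (mkseq (an a) 15) (mkseq (ag a) 15) a.
  by split=> // r; [case/andP=> _ r15 | case/andP=> r15 _]; rewrite nth_mkseq.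
have cs := const_stage (B := B) mu_gt1 N_small.
have asg := @assign_stage _ _ _ B.
do 7! [apply: spec_step; [by apply: cs; try eassumption | by [] | move=> {h0} ? h0]].
do 4! [apply: spec_step; [by apply: asg; try eassumption | by [] | move=> {h0} ? h0]].
rewrite /= e0 e1 e2 e3 mulgV in h0.
apply: spec_weaken (asg _ _ _ _ _ _ _ h0) _ _ _ => // a' /= ha'.
by do 14! eexists; exact: ha'.
Qed.

Lemma is1_stage d e nl vl a lo hi Q p : all named (gvars e) -> holds nl vl a ->
    (forall a', ag a' 6 = geval (nth 1%g vl) e ->
       an a' d = (geval (nth 1%g vl) e == 1%g) ->
       (forall r, r != d -> an a' r = an a r) ->
       (forall r, r != 6 -> ag a' r = ag a r) -> atape a' = atape a ->
       spec B p a' lo hi Q) ->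
  spec B (Seq (assign 6 e) (Seq (EIs1 d 6) p)) a lo (gcost e + 3 + hi) Q.
Proof.
case: a => n v tp ev [/= nE vE tE] sp.
have ev' : all (fun i => i < scratch) (gvars e) by apply: sub_all ev => i /andP[].
have ee : geval v e = geval (nth 1%g vl) e.
  by apply: eq_geval => i /(allP ev); apply: vE.
apply: spec_step; [exact: (spec_assign _ ev') | by lia | move=> _ <-].
apply: spec_step; [exact: spec_is1 | by lia | move=> _ <-].
apply: spec_weaken (sp _ _ _ _ _ _) _ _ _; rewrite /= /upd ?eqxx ?ee //=; try lia.
- by move=> r /negPf->.
- by move=> r /negPf->.
Qed.

Lemma delta_spec nl vl a : holds nl vl a -> nth 1%g vl 0 = x -> nth 1%g vl 2 = z ->
  spec B delta_prog a 0 100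
    (holds (set_nth 0 nl 12 (nth 1%g vl 7 != x ^+ 2)%g)
           (set_nth 1%g vl 11 (z ^+ (nth 1%g vl 7 != x ^+ 2))%g)).
Proof.
move=> ha vx vz.
apply: spec_weaken (@is1_stage 6 (GMul (GInv gj) (GVar 7)) nl vl a 0 60
  (holds (set_nth 0 nl 12 (nth 1%g vl 7 != x ^+ 2)%g)
           (set_nth 1%g vl 11 (z ^+ (nth 1%g vl 7 != x ^+ 2))%g))
  _ isT ha _) _ _ _ => // a' _ a6 an_frame ag_frame at_eq.
have ha' : holds nl vl a'.
  case: ha => nE vE tE; split=> [r rl|r rl|]; rewrite ?at_eq //.
    by rewrite an_frame ?nE //; lia.
  by rewrite ag_frame ?vE //; move: rl; rewrite /named !inE !negb_or => /and4P[].
case: a' {an_frame ag_frame at_eq} a6 ha' => n' v' tp' /= a6 ha'.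
have dE : n' 6 = ~~ (nth 1%g vl 7 != x ^+ 2)%g.
  by rewrite a6 negbK /= vx -eq_mulVg1 eq_sym.
apply: (@spec_weaken _ _ _ _ _ _ 0 (3 + 50) _ _ (holds (set_nth 0 nl 12 (nth 1%g vl 7 != x ^+ 2)%g)
           (set_nth 1%g vl 11 (z ^+ (nth 1%g vl 7 != x ^+ 2))%g))) => //.
move: dE; case: (_ != _) => /= dE; apply: (spec_if mu_gt1 N_small); rewrite dE //= ?N_pos // => _.
  apply: spec_step; [exact: (const_stage mu_gt1 N_small _ _ ha') | by [] |].
  move=> a1 h1; apply: spec_weaken (assign_stage _ _ h1) _ _ _ => // a2 /=.
  by rewrite vz.
apply: spec_step; [exact: (const_stage mu_gt1 N_small _ _ ha') | by [] |].
move=> a1 h1; apply: spec_weaken (assign_stage _ _ h1) _ _ _ => // a2 /=.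
by rewrite vz mulgV.
Qed.

Let j : gT := (x ^+ 2)%g.
Let t i : gT := (x ^ (y ^+ i))%g.
Let v i : gT := (x ^+ i * j ^ (y ^+ i))%g.

(** The lower bound [N] comes from the first loop alone; 30 is the number of cells of
    [answer_template]. *)
Lemma membership_spec a :
    ag a 0 = x -> ag a 1 = y -> ag a 2 = z -> ag a 3 = g -> atape a = [::] ->
  spec B membership a N (N * 1000 + 1000) (fun a' =>
    [/\ (an a' 0 != 0) = (g \in G),
        g \in G -> slp_value [:: x; y; z] (atape a') = Some g &
        slp_length (atape a') <= 30 * maxn 1 (up_log 2 N)]).
Proof.
move=> e0 e1 e2 e3 et; rewrite /membership.
apply: spec_step; [exact: (init_spec e0 e1 e2 e3 et) | by lia |].
move=> a1 [n0 [n1 [n2 [n3 [n4 [n5 [n6 [n12 [v4 [v5 [v6 [v7 [v11 [v12 h1]]]]]]]]]]]]]].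
have ss test cand rn re nl vl a' := @search_stage _ _ _ B N mu_gt1 N_small x y N_pos
  x_exp_N y_exp_N xy_exp test cand rn re nl vl a'.
(* The initial contents [x] and [j] are the values of round 0 that [search_stage] asks for. *)
have t0 : x = t 0 by rewrite /t expg0 conjg1.
have v0 : j = v 0 by rewrite /v !expg0 conjg1 mul1g.
apply: spec_step; [apply: (ss _ _ _ _ _ _ _ _ _ _ _ _ _ _ _ _ _ h1) => // | by rewrite /=; lia |].
move=> a2 [e [eN hit1 h2]]; rewrite /round /upd /= in hit1 h2.
have {}hit1 : (exists k, (j * (j ^ (y ^+ k)) ^ g) ^+ 5 = 1)%g ->
  ((j * (j ^ (y ^+ e)) ^ g) ^+ 5 = 1)%g := hit1.
apply: spec_step; [exact: (assign_stage _ _ h2) | by rewrite /=; lia | move=> a3 h3; rewrite /= in h3].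
set c : gT := ((j ^ (y ^+ e)) ^ g)%g in hit1.
rewrite -[(g^-1 * _)%g]/c in h3.
apply: spec_step; [apply: (ss _ _ _ _ _ _ _ _ _ _ _ _ _ _ _ _ _ h3) => // | by rewrite /=; lia |].
move=> a4 [i1 [i1N hit2 h4]]; rewrite /round /upd /= in hit2 h4.
have {}hit2 : (exists k, (c ^ (x ^ t k))^-1 * j ^ c = 1)%g ->
  ((c ^ (x ^ t i1))^-1 * j ^ c = 1)%g := hit2.
rewrite -[(y ^- i1 * _)%g]/(t i1) in h4.
apply: spec_step; [apply: (ss _ _ _ _ _ _ _ _ _ _ _ _ _ _ _ _ _ h4) => // | by rewrite /=; lia |].
move=> a5 [k1 [k1N hit3 h5]]; rewrite /round /upd /= in hit3 h5.
have {}hit3 : (exists k, c^-1 * (j ^ z) ^ (v k * t i1) = 1)%g ->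
  (c^-1 * (j ^ z) ^ (v k1 * t i1) = 1)%g := hit3.
rewrite -[(x ^+ k1 * _)%g]/(v k1) in h5.
apply: spec_step; [exact: (delta_spec h5) | by rewrite /=; lia | move=> a6 h6; rewrite /= in h6].
set d : bool := (c != j); rewrite -[(c != _)%g]/d in h6.
apply: spec_step; [exact: (assign_stage _ _ h6) | by rewrite /=; lia | move=> a7 h7; rewrite /= in h7].
set g' := (_ * _ * _ * _)%g in h7.
apply: spec_step; [apply: (ss _ _ _ _ _ _ _ _ _ _ _ _ _ _ _ _ _ h7) => // | by rewrite /=; lia |].
move=> a8 [i2 [i2N hit4 h8]]; rewrite /round /upd /= in hit4 h8.
have {}hit4 : (exists k, (x ^ t k)^-1 * x ^ g' = 1)%g ->
  ((x ^ t i2)^-1 * x ^ g' = 1)%g := hit4.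
rewrite -[(y ^- i2 * _)%g]/(t i2) in h8.
apply: spec_step; [apply: (ss _ _ _ _ _ _ _ _ _ _ _ _ _ _ _ _ _ h8) => // | by rewrite /=; lia |].
move=> a9 [k2 [k2N hit5 h9]]; rewrite /round /upd /= in hit5 h9.
have {}hit5 : (exists k, g'^-1 * (v k * t i2) = 1)%g ->
  (g'^-1 * (v k2 * t i2) = 1)%g := hit5.
rewrite -[(x ^+ k2 * _)%g]/(v k2) in h9.
have xG := sl_x L; have yG := sl_y L; have zG := sl_z L.
have tG i : t i \in G by apply: sl_t L i.
have vG i : v i \in G by apply: sl_v L i.
have hG : (y ^+ e)%g \in G by apply: groupX.
have eq1 (p r : gT) : p = r -> (p^-1 * r = 1)%g by move=> ->; rewrite mulVg.
have eq1V (p r : gT) : (p^-1 * r = 1)%g -> p = r.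
  by move/eqP; rewrite -eq_mulVg1 => /eqP.
(* Completeness: for [g] in [G] each search that matters has a solution. When [c = j] the middle
   searches may fail, which is harmless as every [v k * t i] centralises [j]. *)
have in_G : g \in G -> g' = (v k2 * t i2)%g.
  move=> gG; have g'G : g' \in G by rewrite /g' !(groupM, groupV, groupX).
  have jw : (j ^ (v k1 * t i1)^-1 = j)%g.
    apply: (conjg_inj (v k1 * t i1)%g); rewrite conjgKV conjgM.
    by rewrite /v /t /j (sl_j_v L) (sl_j_t L).
  have jg' : (j ^ g' = j)%g.
    rewrite /g' !(conjgM j) -/c /d; have [->|c_neq_j] := eqVneq c j.
      by rewrite jw expg0 conjg1.
    case: (order5_cases L hG gG (hit1 (sl_order5 L gG))) => [cj|[u uG [ju cE]]].
      by case/eqP: c_neq_j; exact: cj.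
    have c_t : (c ^ (x ^ t i1) = j ^ c)%g.
      apply: eq1V; apply: hit2; have [k ek] := sl_cent_j L uG ju.
      by exists k; apply: eq1; rewrite /t ek; apply: (conj_x_eq L ju cE).
    have xt : (x ^ t i1 = x ^ u)%g.
      by apply: (conj_x_unique L uG (tG _) ju (sl_j_t L i1) cE c_t).
    have [k uE] := factor_cent_x L uG (tG _) xt.
    have <- : ((j ^ z) ^ (v k1 * t i1) = c)%g.
      by apply/esym/eq1V/hit3; exists k; apply: eq1; rewrite /v /j -uE.
    by rewrite conjgK expg1 -conjgM (sl_zz L) conjg1.
  have xt : (x ^ t i2 = x ^ g')%g.
    apply: eq1V; apply: hit4; have [k ek] := sl_cent_j L g'G jg'.
    by exists k; apply: eq1.
  apply: eq1V; apply: hit5; have [k g'E] := factor_cent_x L g'G (tG _) xt.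
  by exists k; apply: eq1; rewrite [LHS]g'E.
(* Soundness: the definition of [g'] is solved for [g], with no assumption that [g] lies in [G]. *)
have gE : g' = (v k2 * t i2)%g ->
    g = (y ^- e * (v k2 * t i2) * z ^+ d * (v k1 * t i1))%g.
  move=> <-; rewrite /g' -!mulgA mulKg -[LHS]mulg1; congr (_ * _)%g.
  have zz : (z ^+ d * z ^+ d = 1)%g by case: (d); rewrite ?expg1 ?(sl_zz L) ?mulg1.
  by rewrite [(z ^+ d * _)%g]mulgA zz mul1g mulVg.
set Q := (Q in spec B _ _ _ _ Q).
apply: spec_weaken (@is1_stage 0 _ _ _ a9 0
  (size answer_template * 12 + 1) Q (emit_slp answer_template) _ h9 _) _ _ _ => //.
- move=> a' _ fl an' _ at'; have [nE _ tE] := h9.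
  have {nE}nE r : 8 < r < 15 -> an a' r =
      nth 0 [:: n0; n1; n2; n3; n4; n5; n6; 1; 0; e; i1; k1; d : nat; i2; k2] r.
    case/andP=> r8 r15; rewrite an' ?nE ?r15 ?(ltn_trans _ r8) //.
    by apply: contraTneq r8 => ->.
  rewrite {}tE in at'; rewrite /= in fl.
  case: a' fl at' nE {an'} => n' v' tp' /= fl -> nE.
  have n'N r : 8 < r < 15 -> n' r <= N.
    move=> rl; rewrite nE //; have dN : d <= N by apply: leq_trans N_pos; case: (d).
    by case: r rl => [|[|[|[|[|[|[|[|[|[|[|[|[|[|[|]]]]]]]]]]]]]]].
  apply: spec_weaken (@emit_slp_spec _ _ _ _ _ mu_gt1 N_small
    answer_template n' v' [::] isT _) _ _ _ => //.
    by move=> r rl; apply: (bitlen_small N_small); apply: n'N.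
  move=> a' [tE a'E]; rewrite /Q tE cat0s; split.
  + rewrite a'E // fl; apply/idP/idP => [|/in_G eg].
      case: (g'^-1 * _ =P 1)%g => // /eq1V/gE -> _.
      by rewrite !(groupM, groupV, groupX).
    by rewrite -eg mulVg eqxx.
  + move=> gG; rewrite (gE (in_G gG)) /slp_value /= !nE //=; congr Some.
    by rewrite /v /t /j !mulgA.
  + exact: slp_length_instantiate.
- by rewrite !subn0 subnn !sub0n.
by rewrite /=; move: (N) => N'; clear; lia.
Qed.

End Membership.

(** * Bounds for instances and the worst case *)

Lemma blackbox_log_card (gT : finGroupType) (U : {group gT}) (mu : nat)
  (B : blackbox U mu) : #|U| <= 2 ^ mu.
Proof.
have UB : #|U| <= #|bb_string B|.
  rewrite -cardsT; apply: leq_trans (leq_imset_card (@bb_elt _ _ _ B) _).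
  apply/subset_leq_card/subsetP=> u /(bb_elt_onto B)[s _ <-].
  by apply: imset_f; rewrite inE.
apply: leq_trans UB _; rewrite card_tuple.
apply: leq_trans (leq_pexp2l (isT : 0 < 2) (bb_len_le B)).
rewrite mulnC expnM; have [->//|len_gt0] := posnP (bb_len B).
by rewrite leq_exp2r // up_logP.
Qed.

(** Applied to the running times over all instances, a predicate with no decision procedure at hand;
    hence the excluded middle. *)
Lemma bounded_max (P : nat -> Prop) (K t0 : nat) : P t0 -> (forall t, P t -> t <= K) ->
  exists T, P T /\ forall t, P t -> t <= T.
Proof.
elim: K => [|K IH] Pt0 PK.
  by exists t0; split=> // t /PK; rewrite leqn0 => /eqP->.
case: (classic (P K.+1)) => [PK1|nPK1]; first by exists K.+1.
apply: IH => // t Pt; have := PK t Pt.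
by rewrite leq_eqVlt => /orP[/eqP tK|//]; rewrite tK in Pt.
Qed.

Section Instance.

Variables (m mu : nat) (I : instance m mu).
Hypothesis m_gt0 : 0 < m.

Let N := 4 * (suzq m).-1.

Lemma instance_suzuki_like : suzuki_like (in_G I) (bb_elt (in_x I))
  (bb_elt (in_y I)) (bb_elt (in_z I)) (suzq m).
Proof.
exact: standard_generators_suzuki_like m_gt0 (fc_card (in_field I))
  (in_omegaP I) (in_std I).
Qed.

Lemma suzq_double : suzq m = 2 * 2 ^ (2 * m).
Proof. by rewrite /suzq addn1 expnS. Qed.

Lemma suzq_gt1 : 1 < suzq m.
Proof. by rewrite suzq_double -[2]/(2 * 1) leq_mul ?expn_gt0. Qed.

Lemma mu_ge : 2 * m <= mu.
Proof.
have L := instance_suzuki_like.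
have : (suzq m).-1 <= 2 ^ mu.
  apply: leq_trans (blackbox_log_card (in_bb I)); rewrite -(sl_order_y L).
  apply: subset_leq_card; rewrite cycle_subG.
  exact: (subsetP (in_G_sub I)) (sl_y L).
move=> q_le; rewrite -(@leq_exp2l 2) //; apply: leq_trans q_le; rewrite suzq_double.
by have := expn_gt0 2 (2 * m); lia.
Qed.

Lemma N_le : N <= 2 ^ (2 * m + 3).
Proof. by rewrite /N suzq_double expnD; lia. Qed.

(** The bit length is at most [2 * m + 4], and [2 * m + 4 <= 6 * m <= 3 * mu]. *)
Lemma bitlen_N : bitlen N <= 3 * mu.
Proof.
have := leq_trunc_log 2 N_le; rewrite trunc_expnK // /bitlen.
by have := mu_ge; lia.
Qed.

Lemma initial_represents : represents (initial_state I)
  (AState (nmem (initial_state I)) (val_at (initial_state I)) [::]).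
Proof.
split=> // -[|[|[|[|i]]]] /=; rewrite ?in_x_valid ?in_y_valid ?in_z_valid ?in_g_valid //.
have [iX|iX] := ltnP i (size (in_X I)); first by rewrite in_X_valid ?mem_nth.
by rewrite nth_default ?in_x_valid.
Qed.

Lemma membership_run : exists (t : nat) (s : state (in_bb I)),
  [/\ runs membership t s, N * mu <= t <= (N * 1000 + 1000) * mu,
      accepts (I := I) s = (bb_elt (in_g I) \in in_G I),
      bb_elt (in_g I) \in in_G I ->
        slp_value (in_Y I) (tape s) = Some (bb_elt (in_g I)) &
      slp_length (tape s) <= 30 * maxn 1 (up_log 2 N)].
Proof.
have mu_gt1 : 1 < mu by have := mu_ge; lia.
have even_q : ~~ odd (suzq m) by rewrite suzq_double oddM.
pose a0 := AState (nmem (initial_state I)) (val_at (initial_state I)) [::].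
have sp := @membership_spec _ _ _ (in_bb I) _ _ _ _ (bb_elt (in_g I)) _
  instance_suzuki_like suzq_gt1 even_q mu_gt1 bitlen_N a0
  erefl erefl erefl erefl erefl.
have [t [s [a [xs [_ ns ts _] [acc val len] tb]]]] := sp _ initial_represents.
by exists t, s; split; rewrite ?/accepts ?ns ?ts.
Qed.

End Instance.

Theorem theorem1p2 :
  exists p : prog,
    [/\ solves_membership p,
        time_Theta p (fun m mu => suzq m * mu) &
        slp_length_O p (fun m => trunc_log 2 (suzq m))].
Proof.
exists membership; split.
- move=> m mu I m_gt0; have [t [s [rs _ acc val _]]] := membership_run I m_gt0.
  by exists t, s.
(* With [q = suzq m > 1] one has [q <= 4 * q.-1] and [4 * q.-1 * 1000 + 1000 <= 4000 * q]. *)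
- exists 1, 4000 => m mu m_gt0 [I0].
  pose P t := exists (I : instance m mu) s, @runs m mu I membership t s.
  have q_gt1 := suzq_gt1 m.
  have bound t : P t -> suzq m * mu <= t <= 4000 * (suzq m * mu).
    case=> I [s rs]; have [t' [s' [rs' /andP[lo hi] _ _ _]]] := membership_run I m_gt0.
    (* Determinism carries the bounds from the constructed run to an arbitrary one. *)
    have [-> _] := exec_det rs' rs; apply/andP; split.
      apply: leq_trans lo; rewrite leq_mul2r; apply/orP; right. lia.
    by apply: leq_trans hi _; rewrite mulnA leq_mul2r; apply/orP; right; lia.
  have [t0 [s0 [rs0 _ _ _ _]]] := membership_run I0 m_gt0.
  have [|t /bound/andP[]|T [[I [s rs]] Tmax]] := @bounded_max P (4000 * (suzq m * mu)) t0.
  + by exists I0, s0.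
  + by [].
  have [|lo hi] := andP (bound T _); first by exists I, s.
  exists T; split; rewrite ?mul1n //; split.
    by move=> I' t s' rs'; apply: Tmax; exists I', s'.
  by exists I, T, s.
(* The constant comes from [30 * (2 * m + 3) <= 90 * (2 * m + 1)]. *)
- exists 90 => m mu I t s m_gt0 rs _.
  have [t' [s' [rs' _ _ _ len]]] := membership_run I m_gt0.
  have [_ ->] := exec_det rs' rs; apply: leq_trans len _.
  rewrite trunc_expnK //; have := leq_up_log 2 (N_le m_gt0).
  by rewrite up_expnK //; move: (up_log _ _) => u; lia.
Qed.
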